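(* Let $R$ be a commutative ring and $n\ge1$, $m\ge 2$ integers. (1) The ring $A_R(\infty,m)$ is a polynomial ring over $R$, freely generated by the elements $e_k(\mu)$, where $\mu$ ranges over the primitive monomials of positive degree in $y_1,\dots,y_m$ and $k$ ranges over the positive integers. The kernel of the natural projection $\tilde\pi_n:A_R(\infty,m)\to A_R(n,m)^{S_n}$ is generated as an $R$-module by the coefficients $e_\alpha$ of the elements $e_{n+k}(f)$ with $k\ge 1$ and $f\in A_R(m)^+$, i.e. by the elements $e_\alpha$ with $|\alpha|=n+k$ for some $k\ge1$. (2) If $R\supseteq\mathbb{Q}$, then $A_R(\infty,m)$ is a polynomial ring freely generated by the elements $e_1(\mu)$, $\mu$ a monomial of positive degree in $y_1,\dots,y_m$, and the kernel of $\tilde\pi_n$ is generated as an ideal by the elements $e_{n+1}(f)$, $f\in A_R(m)^+$.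
   Context: Let $A_R(n,m)=R[x_i(j): 1\le i\le m,\ 1\le j\le n]$ (commuting independent variables) with $S_n$ acting by $\sigma(x_i(j))=x_i(\sigma(j))$, and invariant ring $A_R(n,m)^{S_n}$. Let $A_R(m)=R[y_1,\dots,y_m]$ and $A_R(m)^+$ its ideal of polynomials without constant term. For $f\in A_R(m)$ put $f(j):=f(x_1(j),\dots,x_m(j))$. Grade $A_R(n,m)$ by multidegree in $\mathbb{N}^m$, giving $x_i(j)$ the multidegree of $y_i$ (the $i$-th unit vector); $A_R(n,m,a)$ is the $R$-span of monomials of multidegree $a$. Let $\pi_n:A_R(n,m)\to A_R(n-1,m)$ be the $R$-algebra map with $x_i(n)\mapsto 0$ and $x_i(j)\mapsto x_i(j)$ for $j<n$; it maps $A_R(n,m,a)^{S_n}$ onto $A_R(n-1,m,a)^{S_{n-1}}$. Set $A_R(\infty,m,a)=\varprojlim_n A_R(n,m,a)^{S_n}$ (limit along the $\pi_n$) and $A_R(\infty,m)=\bigoplus_{a\in\mathbb{N}^m}A_R(\infty,m,a)$, with the ring structure induced by componentwise multiplication (the $\pi_n$ being multigraded ring homomorphisms); $\tilde\pi_n:A_R(\infty,m)\to A_R(n,m)^{S_n}$ is the natural projection. Let $\mathcal{M}_m^+$ be the set of monomials in $y_1,\dots,y_m$ of positive degree; a monomial in $\mathcal M_m^+$ is primitive if it is not $\nu^k$ with $\nu$ a monomial and $k\ge2$. For a finitely supported $\alpha:\mathcal M_m^+\to\mathbb{N}$ put $|\alpha|=\sum_\mu\alpha(\mu)$; for $n\ge|\alpha|$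 let $e_\alpha(n)\in A_R(n,m)^{S_n}$ be the coefficient of $\prod_\mu t_\mu^{\alpha(\mu)}$ in $\prod_{i=1}^n\bigl(1+\sum_{\mu\in\mathcal M_m^+}t_\mu\,\mu(i)\bigr)$ (independent indeterminates $t_\mu$), and $e_\alpha(n)=0$ for $n<|\alpha|$; these are compatible under the $\pi_n$ and define $e_\alpha\in A_R(\infty,m)$. For $\mu\in\mathcal M_m^+$ and $k\ge1$, $e_k(\mu)=e_\alpha$ with $\alpha(\mu)=k$ and $\alpha(\nu)=0$ for $\nu\ne\mu$. For $f=\sum_{\mu\in\mathcal M_m^+}\lambda_\mu\mu\in A_R(m)^+$ (finite sum, $\lambda_\mu\in R$), set $e_k(f):=\sum_{|\alpha|=k}\bigl(\prod_\mu\lambda_\mu^{\alpha(\mu)}\bigr)e_\alpha\in A_R(\infty,m)$; this is the limit of the coefficients of $t^k$ in $\prod_{j=1}^n(1+tf(j))$. *)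

(* Defs.v *)
From HB Require Import structures.
From mathcomp Require Import all_boot all_order all_algebra all_fingroup finmap.
From mathcomp Require Import boolp classical_sets cardinality fsbigop.
From mathcomp Require Import monalg.

Set Implicit Arguments.
Unset Strict Implicit.
Unset Printing Implicit Defensive.

Import GRing.Theory.
Local Open Scope ring_scope.

(* Polynomial rings in an arbitrary (possibly infinite) set  *)
(* I of variables are the monoid algebras {malg R[{cmonom I}]} of monalg;     *)
(* U_(i) below is the variable i seen as a monomial.                          *)
Local Notation "'U_(' i )" := (@ucm _ i) : monom_scope.
Local Notation "1" := (@mone _) : monom_scope.
Local Notation "x * y" := (mmul x y) : monom_scope.

Section Evaluation.
Context {I : choiceType}.

Definition cmval (S : comNzRingType) (v : I -> S) (k : {cmonom I}) : S :=
  \prod_(i <- finsupp k) v i ^+ k i.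

Lemma cmvalEw (S : comNzRingType) (v : I -> S) (d : {fset I}) (k : {cmonom I}) :
  (finsupp k `<=` d)%fset -> cmval v k = \prod_(i <- d) v i ^+ k i.
Proof.
move=> le; rewrite /cmval (big_fset_incl _ le) //= => i _.
by rewrite -cmE_neq0 negbK => /eqP->; rewrite expr0.
Qed.

Lemma cmval_is_mmorphism (S : comNzRingType) (v : I -> S) :
  mmorphism (cmval v).
Proof.
split=> [x y|]; last by rewrite /cmval mdom1 big_seq_fset0.
rewrite [LHS](_ : _ = \prod_(i <- (finsupp x `|` finsupp y)%fset)
    v i ^+ (x * y)%M i); last by rewrite /cmval mdomD.
rewrite (cmvalEw v (fsubsetUl _ (finsupp y))).
rewrite (cmvalEw v (fsubsetUr (finsupp x) _)) -big_split /=.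
by apply: eq_bigr => i _; rewrite cmM exprD.
Qed.

HB.instance Definition _ (S : comNzRingType) (v : I -> S) :=
  isMultiplicative.Build {cmonom I} S (cmval v) (cmval_is_mmorphism v).

Context {R : comNzRingType}.

(* The R-algebra map R[I] -> A sending the variable i to v i *)
Definition peval (A : comAlgType R) (v : I -> A) (p : {malg R[{cmonom I}]}) : A :=
  mmap (in_alg A) (cmval v) p.

Lemma peval_is_linear (A : comAlgType R) (v : I -> A) : linear (peval v).
Proof.
by move=> c p q; rewrite /peval [LHS]raddfD /= mmapZ /= mulr_algl.
Qed.

Lemma peval_is_multiplicative (A : comAlgType R) (v : I -> A) :
  multiplicative (peval v).
Proof. exact: mmap_is_multiplicative. Qed.

HB.instance Definition _ (A : comAlgType R) (v : I -> A) :=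
  GRing.isLinear.Build R {malg R[{cmonom I}]} A _ (peval v) (peval_is_linear v).
HB.instance Definition _ (A : comAlgType R) (v : I -> A) :=
  GRing.isMultiplicative.Build {malg R[{cmonom I}]} A (peval v)
    (peval_is_multiplicative v).

Lemma pevalU (A : comAlgType R) (v : I -> A) c k :
  peval v << c *g k >> = c *: cmval v k.
Proof. by rewrite /peval mmapU /= mulr_algl. Qed.

Lemma pevalX (A : comAlgType R) (v : I -> A) i : peval v << U_(i)%M >> = v i.
Proof. by rewrite pevalU scale1r /cmval mdomU big_seq_fset1 cmUU expr1. Qed.

End Evaluation.

Definition freely_generated (R : comNzRingType) (A : comAlgType R)
    (I : choiceType) (g : I -> A) : Prop :=
  bijective (peval g : {malg R[{cmonom I}]} -> A).

Definition module_span (R : pzRingType) (V : lmodType R) (P : set V) : set V :=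
  fun x => exists2 s : seq (R * V),
    (forall p, p \in s -> P p.2) & x = \sum_(p <- s) p.1 *: p.2.

Definition ideal_span (A : comPzRingType) (P : set A) : set A :=
  fun x => exists2 s : seq (A * A),
    (forall p, p \in s -> P p.2) & x = \sum_(p <- s) p.1 * p.2.

Notation Apoly R n m := {malg R[{cmonom ('I_m * 'I_n)%type}]}.

Section MultisymmetricRing.
Context {R : comNzRingType} {m : nat}.
Implicit Types (n : nat).

Local Notation A n := (Apoly R n m).

(* x_i(j) *)
Definition xvar {n} (i : 'I_m) (j : 'I_n) : A n := << U_((i, j))%M >>.

(* sigma(x_i(j)) = x_i(sigma(j)) *)
Definition symact {n} (s : 'S_n) : A n -> A n :=
  peval (fun ij => xvar ij.1 (s ij.2)).

HB.instance Definition _ n (s : 'S_n) :=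
  GRing.isLinear.Build R (A n) (A n) _ (symact s)
    (peval_is_linear _).
HB.instance Definition _ n (s : 'S_n) :=
  GRing.isMultiplicative.Build (A n) (A n) (symact s)
    (peval_is_multiplicative _).

Definition invariant {n} (p : A n) : Prop := forall s : 'S_n, symact s p = p.

(* f |-> f(j) *)
Definition at_point {n} (j : 'I_n) (f : {malg R[{cmonom 'I_m}]}) : A n :=
  peval (fun i => xvar i j) f.

HB.instance Definition _ n (j : 'I_n) :=
  GRing.isLinear.Build R {malg R[{cmonom 'I_m}]} (A n) _ (at_point j)
    (peval_is_linear _).
HB.instance Definition _ n (j : 'I_n) :=
  GRing.isMultiplicative.Build {malg R[{cmonom 'I_m}]} (A n) (at_point j)
    (peval_is_multiplicative _).

Definition multidegree {n} (k : {cmonom ('I_m * 'I_n)%type}) : {ffun 'I_m -> nat} :=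
  [ffun i => (\sum_(j < n) k (i, j))%N].

(* membership in A_R(n,m,a) *)
Definition homog {n} (a : {ffun 'I_m -> nat}) (p : A n) : Prop :=
  forall k, k \in msupp p -> multidegree k = a.

Definition pivar n (ij : 'I_m * 'I_n.+1) : A n :=
  if unlift ord_max ij.2 is Some j then xvar ij.1 j else 0.

(* x_i(j) |-> x_i(j) for j < n, x_i(n) |-> 0 (ordinals start at 0) *)
Definition pi n : A n.+1 -> A n := peval (@pivar n).

HB.instance Definition _ n :=
  GRing.isLinear.Build R (A n.+1) (A n) _ (@pi n)
    (peval_is_linear _).
HB.instance Definition _ n :=
  GRing.isMultiplicative.Build (A n.+1) (A n) (@pi n)
    (peval_is_multiplicative _).

End MultisymmetricRing.

Arguments pi {R m} n.

Section Limit.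
Variables (R : comNzRingType) (m : nat).

Definition Aseq : Type := forall n, Apoly R n m.

HB.instance Definition _ := Choice.copy Aseq (forall n, Apoly R n m).

Implicit Types (f g h : Aseq).

Lemma AseqP f g : (forall n, f n = g n) -> f = g.
Proof. exact: functional_extensionality_dep. Qed.

Definition seq0 : Aseq := fun n => 0.
Definition seq1 : Aseq := fun n => 1.
Definition seqN f : Aseq := fun n => - f n.
Definition seqD f g : Aseq := fun n => f n + g n.
Definition seqM f g : Aseq := fun n => f n * g n.
Definition seqZ (c : R) f : Aseq := fun n => c *: f n.

Lemma seqDA : associative seqD.
Proof. by move=> f g h; apply: AseqP => n; exact: addrA. Qed.
Lemma seqDC : commutative seqD.
Proof. by move=> f g; apply: AseqP => n; exact: addrC. Qed.
Lemma seq0D : left_id seq0 seqD.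
Proof. by move=> f; apply: AseqP => n; exact: add0r. Qed.
Lemma seqND : left_inverse seq0 seqN seqD.
Proof. by move=> f; apply: AseqP => n; exact: addNr. Qed.

HB.instance Definition _ := GRing.isZmodule.Build Aseq seqDA seqDC seq0D seqND.

Lemma seqMA : associative seqM.
Proof. by move=> f g h; apply: AseqP => n; exact: mulrA. Qed.
Lemma seqMC : commutative seqM.
Proof. by move=> f g; apply: AseqP => n; exact: mulrC. Qed.
Lemma seq1M : left_id seq1 seqM.
Proof. by move=> f; apply: AseqP => n; exact: mul1r. Qed.
Lemma seqMDl : left_distributive seqM +%R.
Proof. by move=> f g h; apply: AseqP => n; exact: mulrDl. Qed.
Lemma seq1_neq0 : seq1 != 0.
Proof.
apply/eqP => /(congr1 (fun f : Aseq => f 0%N)) /eqP.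
by rewrite [_ == _]oner_eq0.
Qed.

HB.instance Definition _ :=
  GRing.Zmodule_isComNzRing.Build Aseq seqMA seqMC seq1M seqMDl seq1_neq0.

Lemma seqZA a b f : seqZ a (seqZ b f) = seqZ (a * b) f.
Proof. by apply: AseqP => n; exact: scalerA. Qed.
Lemma seq1Z : left_id 1 seqZ.
Proof. by move=> f; apply: AseqP => n; exact: scale1r. Qed.
Lemma seqZDr : right_distributive seqZ +%R.
Proof. by move=> c f g; apply: AseqP => n; exact: scalerDr. Qed.
Lemma seqZDl f : {morph seqZ^~ f : a b / a + b}.
Proof. by move=> a b; apply: AseqP => n; exact: scalerDl. Qed.

HB.instance Definition _ :=
  GRing.Zmodule_isLmodule.Build R Aseq seqZA seq1Z seqZDr seqZDl.

Lemma seqZAl (c : R) f g : c *: (f * g) = (c *: f) * g.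
Proof. by apply: AseqP => n; exact: scalerAl. Qed.

HB.instance Definition _ := GRing.Lmodule_isLalgebra.Build R Aseq seqZAl.
HB.instance Definition _ := GRing.Lalgebra_isComAlgebra.Build R Aseq.

Lemma Aseq_sumE (T : Type) (s : seq T) (F : T -> Aseq) n :
  (\sum_(i <- s) F i) n = \sum_(i <- s) F i n.
Proof. by elim/big_rec2: _ => // i p f _ <-. Qed.

(* A_R(oo,m,a), the inverse limit along the pi_n, as compatible families.     *)
(* The index set starts at n = 0, which changes nothing since pi determines   *)
(* the 0-th component from the next one.                                      *)
Definition limA (a : {ffun 'I_m -> nat}) : set Aseq := fun f =>
  (forall n, homog a (f n) /\ invariant (f n)) /\
  (forall n, pi n (f n.+1) = f n).

(* A_R(oo,m) is the sum of the submodules limA a of the product ring Aseq;    *)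
(* by limA_direct below this sum is direct.                                   *)
Definition Ainf_pred : {pred Aseq} := fun f =>
  `[< exists2 s : seq ({ffun 'I_m -> nat} * Aseq),
        (forall p, p \in s -> limA p.1 p.2) & f = \sum_(p <- s) p.2 >].

End Limit.

Section LimitRing.
Context {R : comNzRingType} {m : nat}.
Local Notation A n := (Apoly R n m).
Local Notation deg := {ffun 'I_m -> nat}.
Implicit Types (a b : deg) (f g : Aseq R m).

Lemma multidegree1 n : multidegree (1%M : {cmonom ('I_m * 'I_n)%type}) = 0.
Proof. by apply/ffunP => i; rewrite !ffunE big1 // => j _; rewrite cm1. Qed.

Lemma multidegreeM n (k l : {cmonom ('I_m * 'I_n)%type}) :
  multidegree (k * l)%M = multidegree k + multidegree l.
Proof.
apply/ffunP => i; rewrite !ffunE -big_split /=.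
by apply: eq_bigr => j _; rewrite cmM.
Qed.

Lemma homog0 n a : homog a (0 : A n).
Proof. by move=> k; rewrite msupp0 in_fset0. Qed.

Lemma homog1 n : homog 0 (1 : A n).
Proof. by move=> k; rewrite msuppU1 in_fset1 => /eqP->; exact: multidegree1. Qed.

Lemma homogD n a (p q : A n) : homog a p -> homog a q -> homog a (p + q).
Proof.
move=> hp hq k /(fsubsetP (msuppD_le _ _)).
by rewrite in_fsetU => /orP[/hp|/hq].
Qed.

Lemma homogZ n a (c : R) (p : A n) : homog a p -> homog a (c *: p).
Proof. by move=> hp k /(fsubsetP (msuppZ_le _ _)) /hp. Qed.

Lemma homogM n a b (p q : A n) : homog a p -> homog b q -> homog (a + b) (p * q).
Proof.
move=> hp hq k /msuppM_le [k1 [k2 [/hp h1 /hq h2 ->]]].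
by rewrite multidegreeM h1 h2.
Qed.

Lemma homog_sum n a (T : eqType) (s : seq T) (F : T -> A n) :
  (forall i, i \in s -> homog a (F i)) -> homog a (\sum_(i <- s) F i).
Proof.
move=> h; rewrite big_seq; elim/big_ind: _ => //; first exact: homog0.
by move=> p q; exact: homogD.
Qed.

Lemma limA1 : limA 0 (1 : Aseq R m).
Proof.
split=> n; last exact: rmorph1.
by split; [exact: homog1 | move=> s; exact: rmorph1].
Qed.

Lemma limAM a b f g : limA a f -> limA b g -> limA (a + b) (f * g).
Proof.
move=> [hf cf] [hg cg]; split=> n; last by rewrite [LHS]rmorphM /= cf cg.
split; first by apply: homogM; [case: (hf n) | case: (hg n)].
by move=> s; rewrite [LHS]rmorphM /= (hf n).2 (hg n).2.
Qed.

Lemma limAZ a (c : R) f : limA a f -> limA a (c *: f).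
Proof.
move=> [hf cf]; split=> n; last by rewrite [LHS]linearZ /= cf.
split; first by apply: homogZ; case: (hf n).
by move=> s; rewrite [LHS]linearZ /= (hf n).2.
Qed.

Lemma limA_direct (s : seq deg) (F : deg -> Aseq R m) : uniq s ->
  (forall a, a \in s -> limA a (F a)) -> \sum_(a <- s) F a = 0 ->
  forall a, a \in s -> F a = 0.
Proof.
move=> us hF s0 a sa; apply: AseqP => n; apply/malgP => k; rewrite mcoeff0.
have [ka|ka] := boolP (k \in msupp (F a n)); last exact: mcoeff_outdom.
have := congr1 (fun f : Aseq R m => (f n)@_k) s0.
rewrite Aseq_sumE raddf_sum /= (bigD1_seq a) //= big_seq_cond big1 ?addr0.
  by move=> ->; rewrite mcoeff0.
move=> b /andP[sb ba]; apply: mcoeff_outdom; apply: contraNN ba => kb.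
by rewrite -(((hF a sa).1 n).1 _ ka) (((hF b sb).1 n).1 _ kb).
Qed.

Lemma Ainf_subalg_closed : subalg_closed (@Ainf_pred R m).
Proof.
split.
- apply/asboolP; exists [:: (0, 1)]; last by rewrite big_seq1.
  by move=> p; rewrite inE => /eqP->; exact: limA1.
- move=> c f g /asboolP[s hs ->] /asboolP[t ht ->]; apply/asboolP.
  exists ([seq (p.1, c *: p.2) | p <- s] ++ t).
    move=> p; rewrite mem_cat => /orP[/mapP[q /hs hq ->]|/ht//].
    exact: limAZ.
  by rewrite big_cat big_map /= scaler_sumr.
- move=> f g /asboolP[s hs ->] /asboolP[t ht ->]; apply/asboolP.
  exists [seq (p.1 + q.1, p.2 * q.2) | p <- s, q <- t].
    by move=> p /allpairsP[[p1 p2] /= [/hs h1 /ht h2 ->]]; exact: limAM.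
  rewrite big_allpairs_dep /= mulr_suml; apply: eq_bigr => p _.
  by rewrite mulr_sumr.
Qed.

HB.instance Definition _ :=
  GRing.isSubalgClosed.Build R (Aseq R m) (@Ainf_pred R m) Ainf_subalg_closed.

End LimitRing.

Record Ainf (R : comNzRingType) (m : nat) : Type :=
  MkAinf { Ainf_val : Aseq R m; Ainf_valP : Ainf_val \in @Ainf_pred R m }.

HB.instance Definition _ R m := [isSub for @Ainf_val R m].
HB.instance Definition _ R m := [Choice of Ainf R m by <:].
HB.instance Definition _ R m := [SubChoice_isSubAlgebra of Ainf R m by <:].
HB.instance Definition _ (R : comNzRingType) m :=
  [SubNzRing_isSubComNzRing of Ainf R m by <:].

Section Invariants.
Context {R : comNzRingType} {m : nat}.

Definition invariant_pred n : {pred Apoly R n m} := fun p => `[< invariant p >].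

Lemma invariant_subalg_closed n : subalg_closed (@invariant_pred n).
Proof.
split.
- by apply/asboolP => s; rewrite rmorph1.
- move=> c p q /asboolP hp /asboolP hq; apply/asboolP => s.
  by rewrite linearP /= hp hq.
- move=> p q /asboolP hp /asboolP hq; apply/asboolP => s.
  by rewrite rmorphM /= hp hq.
Qed.

HB.instance Definition _ n :=
  GRing.isSubalgClosed.Build R (Apoly R n m) (@invariant_pred n)
    (@invariant_subalg_closed n).

End Invariants.

(* A_R(n,m)^{S_n} *)
Record Asym (R : comNzRingType) (n m : nat) : Type :=
  MkAsym { Asym_val : Apoly R n m; Asym_valP : Asym_val \in @invariant_pred R m n }.

HB.instance Definition _ R n m := [isSub for @Asym_val R n m].
HB.instance Definition _ R n m := [Choice of Asym R n m by <:].
HB.instance Definition _ R n m := [SubChoice_isSubAlgebra of Asym R n m by <:].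
HB.instance Definition _ (R : comNzRingType) n m :=
  [SubNzRing_isSubComNzRing of Asym R n m by <:].

Section Projection.
Context {R : comNzRingType} {m : nat}.
Implicit Types (x y : Ainf R m).

Lemma Ainf_invariant x n : val x n \in @invariant_pred R m n.
Proof.
case: x => f /= /asboolP[s hs ->]; rewrite Aseq_sumE big_seq.
by apply: rpred_sum => p /hs [h _]; apply/asboolP; exact: (h n).2.
Qed.

Definition pitilde n (x : Ainf R m) : Asym R n m := MkAsym (Ainf_invariant x n).

Lemma pitilde_is_linear n : linear (pitilde n).
Proof. by move=> c x y; exact: val_inj. Qed.
Lemma pitilde_is_multiplicative n : multiplicative (pitilde n).
Proof. by split=> [x y|]; exact: val_inj. Qed.

HB.instance Definition _ n :=
  GRing.isLinear.Build R (Ainf R m) (Asym R n m) _ (pitilde n)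
    (pitilde_is_linear n).
HB.instance Definition _ n :=
  GRing.isMultiplicative.Build (Ainf R m) (Asym R n m) (pitilde n)
    (pitilde_is_multiplicative n).

End Projection.

Record Mplus (m : nat) : Type :=
  MkMplus { Mplus_val : {cmonom 'I_m}; Mplus_valP : (0 < mdeg Mplus_val)%N }.

HB.instance Definition _ m := [isSub for @Mplus_val m].
HB.instance Definition _ m := [Choice of Mplus m by <:].

Definition primitive m (mu : Mplus m) : Prop :=
  forall (nu : {cmonom 'I_m}) (k : nat), (2 <= k)%N -> val mu <> expcmn nu k.

Section EAlpha.
Context {R : comNzRingType} {m : nat}.
Local Notation A n := (Apoly R n m).
Local Notation deg := {ffun 'I_m -> nat}.
Local Notation T n := {malg (A n)[{cmonom (Mplus m)}]}.

(* The product of the 1 + \sum_mu t_mu mu(j), with mu restricted to the       *)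
(* finite set d: t_mu is the variable U_(mu) of T n.                          *)
Definition egen n (d : {fset Mplus m}) : T n :=
  \prod_(j < n) (1 + \sum_(mu <- d) << at_point j << val mu >> *g U_(mu)%M >>).

(* A finitely supported alpha : Mplus m -> nat is the same thing as the       *)
(* monomial \prod_mu t_mu ^ alpha(mu).  Its coefficient does not change when  *)
(* the t_mu with alpha(mu) = 0 are set to 0, hence the choice of d; and it is *)
(* 0 when n < |alpha| (ealpha_seq_small).                                     *)
Definition ealpha_seq (alpha : {cmonom (Mplus m)}) : Aseq R m :=
  fun n => (egen n (finsupp alpha))@_alpha.

Lemma ealpha_seq_small alpha n : (n < mdeg alpha)%N -> ealpha_seq alpha n = 0.
Proof.
suff H k : k \in msupp (egen n (finsupp alpha)) -> (mdeg k <= n)%N.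
  move=> h; apply: mcoeff_outdom; apply/negP => /H.
  by rewrite leqNgt h.
rewrite -[leqRHS]card_ord -sum1_card /egen.
elim/big_ind2: _ k => [k|p a q b hp hq k|j _ k].
- by rewrite msuppU1 in_fset1 => /eqP->; rewrite mdeg1.
- by case/msuppM_le => k1 [k2 [/hp h1 /hq h2 ->]]; rewrite mdegM leq_add.
- move/(fsubsetP (msuppD_le _ _)); rewrite in_fsetU => /orP[].
    by rewrite msuppU1 in_fset1 => /eqP->; rewrite mdeg1.
  elim/big_ind: _ => [|p q hp hq|mu _]; first by rewrite msupp0.
    by move/(fsubsetP (msuppD_le _ _)); rewrite in_fsetU => /orP[/hp|/hq].
  by move/(fsubsetP msuppU_le); rewrite in_fset1 => /eqP->; rewrite mdegU.
Qed.

Definition monU (S : comNzRingType) (K : choiceType) (k : {cmonom K}) :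
  {malg S[{cmonom K}]} := << k >>.

Lemma monU_is_mmorphism (S : comNzRingType) (K : choiceType) :
  mmorphism (@monU S K).
Proof. by split=> // x y; rewrite malgM_def fgmulUU mulr1. Qed.

HB.instance Definition _ (S : comNzRingType) (K : choiceType) :=
  isMultiplicative.Build {cmonom K} {malg S[{cmonom K}]}
    (@monU S K) (monU_is_mmorphism S K).

Section MapCoef.
Variables (S S' : comNzRingType) (K : choiceType) (phi : {rmorphism S -> S'}).

Definition mapcoef (p : {malg S[{cmonom K}]}) : {malg S'[{cmonom K}]} :=
  mmap (malgC \o phi) (@monU S' K) p.

HB.instance Definition _ :=
  GRing.RMorphism.copy mapcoef (mmap (malgC \o phi) (@monU S' K)).

Lemma mapcoefU c k : mapcoef << c *g k >> = << phi c *g k >>.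
Proof. by rewrite /mapcoef mmapU /= /monU malgM_def fgmulUU mulr1 mul1m. Qed.

Lemma mapcoefE p k : (mapcoef p)@_k = phi p@_k.
Proof.
have -> : mapcoef p = \sum_(l <- msupp p) << phi p@_l *g l >>.
  rewrite [in LHS](monalgE p) rmorph_sum.
  by apply: eq_bigr => l _; exact: mapcoefU.
rewrite [in RHS](monalgE p) !raddf_sum.
by apply: eq_bigr => l _ /=; rewrite !mcoeffU raddfMn.
Qed.

End MapCoef.

Lemma mapcoef_egen n n' (phi : {rmorphism A n -> A n'}) d :
  mapcoef phi (egen n d) =
  \prod_(j < n) (1 + \sum_(mu <- d) << phi (at_point j << val mu >>) *g U_(mu)%M >>).
Proof.
rewrite rmorph_prod; apply: eq_bigr => j _.
rewrite rmorphD rmorph1 rmorph_sum /=; congr (_ + _).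
by apply: eq_bigr => mu _; rewrite mapcoefU.
Qed.

Lemma lrmorph_peval (I : choiceType) (B C : comAlgType R)
    (phi : {lrmorphism B -> C}) (v : I -> B) p :
  phi (peval v p) = peval (phi \o v) p.
Proof.
rewrite /peval !mmapE rmorph_sum; apply: eq_bigr => k _.
rewrite rmorphM /= rmorph_alg; congr (_ * _).
by rewrite rmorph_prod; apply: eq_bigr => i _; rewrite rmorphXn.
Qed.

Lemma symact_at_point n (s : 'S_n) (j : 'I_n) (f : {malg R[{cmonom 'I_m}]}) :
  symact s (at_point j f) = at_point (s j) f.
Proof.
rewrite /at_point (lrmorph_peval (symact s : {lrmorphism A n -> A n})); congr (peval _ f).
by apply/funext => i; rewrite /= [LHS]pevalX.
Qed.

Lemma pi_at_point n (j : 'I_n) (f : {malg R[{cmonom 'I_m}]}) :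
  pi n (at_point (lift ord_max j) f) = at_point j f.
Proof.
rewrite /at_point (lrmorph_peval (pi n : {lrmorphism A n.+1 -> A n})); congr (peval _ f).
by apply/funext => i; rewrite /= [LHS]pevalX /pivar liftK.
Qed.

Lemma rmorph_cmval (I : choiceType) (S S' : comNzRingType)
    (phi : {rmorphism S -> S'}) (v : I -> S) k :
  phi (cmval v k) = cmval (phi \o v) k.
Proof. by rewrite rmorph_prod; apply: eq_bigr => i _; rewrite rmorphXn. Qed.

Lemma cmval_eq0 (I : choiceType) (S : comNzRingType) (v : I -> S)
    (k : {cmonom I}) :
  (0 < mdeg k)%N -> (forall i, v i = 0) -> cmval v k = 0.
Proof.
move=> k0 v0; have [e|[i ki]] := fset_0Vmem (finsupp k).
  by rewrite mdegE e big_seq_fset0 in k0.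
rewrite /cmval (big_fsetD1 i) //= v0 expr0n cmE_eq0 ki.
exact: mul0r.
Qed.

Lemma at_pointU n (j : 'I_n) (k : {cmonom 'I_m}) :
  at_point j << k >> = cmval (fun i => xvar i j) k :> A n.
Proof. by rewrite /at_point pevalU scale1r. Qed.

Lemma pi_at_point_max n (mu : Mplus m) :
  pi n (at_point (@ord_max n) << val mu >>) = 0 :> A n.
Proof.
rewrite at_pointU (rmorph_cmval (pi n : {rmorphism A n.+1 -> A n})); apply: cmval_eq0 (valP mu) _ => i.
by rewrite /= [LHS]pevalX /pivar unlift_none.
Qed.

Definition mondeg (mu : Mplus m) : deg := [ffun i => val mu i].

Definition wt (alpha : {cmonom (Mplus m)}) : deg :=
  \sum_(mu <- finsupp alpha) mondeg mu *+ alpha mu.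

Lemma wtEw (d : {fset Mplus m}) (k : {cmonom (Mplus m)}) :
  (finsupp k `<=` d)%fset -> wt k = \sum_(mu <- d) mondeg mu *+ k mu.
Proof.
move=> le; rewrite /wt (big_fset_incl _ le) //= => i _.
by rewrite -cmE_neq0 negbK => /eqP->.
Qed.

Lemma wtM k l : wt (k * l)%M = wt k + wt l.
Proof.
rewrite {1}/wt mdomD (wtEw (fsubsetUl _ (finsupp l))).
rewrite (wtEw (fsubsetUr (finsupp k) _)) -big_split /=.
by apply: eq_bigr => mu _; rewrite cmM mulrnDr.
Qed.

Lemma homogX n (a : deg) (p : A n) e : homog a p -> homog (a *+ e) (p ^+ e).
Proof.
move=> h; elim: e => [|e IH]; first by rewrite expr0; exact: homog1.
by rewrite exprS mulrS; exact: homogM.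
Qed.

Lemma homog_at_point n (j : 'I_n) (mu : Mplus m) :
  homog (mondeg mu) (at_point j << val mu >> : A n).
Proof.
rewrite at_pointU /cmval.
pose dl (i : 'I_m) : deg := [ffun i' => nat_of_bool (i == i')].
have -> : mondeg mu = \sum_(i <- finsupp (val mu)) dl i *+ val mu i.
  apply/ffunP => i; rewrite sum_ffunE !ffunE.
  have [ki|ki] := boolP (i \in finsupp (val mu)).
    rewrite (big_fsetD1 i) //= big_seq big1 ?addr0.
      by rewrite ffunMnE ffunE eqxx -mulr_natr mul1r natn.
    move=> i'; rewrite in_fsetD1 => /andP[ne _].
    by rewrite ffunMnE ffunE (negbTE ne) mul0rn.
  rewrite big_seq big1; first by apply/eqP; rewrite cmE_eq0.
  move=> i' i'k; rewrite ffunMnE ffunE; case: eqP => [e|]; last by rewrite mul0rn.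
  by rewrite -e i'k in ki.
elim/big_rec2: _ => [|i b p _ hp]; first exact: homog1.
apply: homogM => //; apply: homogX => k; rewrite msuppU1 in_fset1 => /eqP->.
apply/ffunP => i'; rewrite !ffunE (bigD1 j) //= big1 ?addn0.
  by rewrite cmU xpair_eqE eqxx andbT.
by move=> j' ne; rewrite cmU xpair_eqE (eq_sym j) (negbTE ne) andbF.
Qed.

Lemma homog_egen n d k : homog (wt k) (egen n d)@_k.
Proof.
have wt1 : wt 1%M = 0 by rewrite /wt mdom1 big_seq_fset0.
have h1 l : homog (wt l) (1 : T n)@_l.
  rewrite mcoeff1; case: eqP => [->|_]; last exact: homog0.
  by rewrite wt1; exact: homog1.
rewrite /egen; elim/big_ind: _ k => // [p q hp hq k|j _ k].
  rewrite mcoeffMl; apply: homog_sum => k1 _; apply: homog_sum => k2 _.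
  case: eqP => [<-|_]; last exact: homog0.
  by rewrite wtM; exact: homogM.
rewrite mcoeffD; apply: homogD => //; rewrite raddf_sum.
apply: homog_sum => mu _ /=; rewrite mcoeffU.
case: eqP => [<-|_]; last exact: homog0.
by rewrite mulr1n /wt mdomU big_seq_fset1 cmUU; exact: homog_at_point.
Qed.

Lemma eq_factor n (d : {fset Mplus m}) (c c' : Mplus m -> A n) : c =1 c' ->
  1 + \sum_(mu <- d) << c mu *g U_(mu)%M >> =
  1 + \sum_(mu <- d) << c' mu *g U_(mu)%M >> :> T n.
Proof. by move/funext=> ->. Qed.

Lemma ealpha_lim alpha : limA (wt alpha) (ealpha_seq alpha).
Proof.
rewrite /ealpha_seq; split=> n.
  split; first exact: homog_egen.
  move=> s; pose phi : {rmorphism A n -> A n} := symact s.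
  rewrite -[LHS](mapcoefE phi); congr (_@_alpha).
  rewrite mapcoef_egen /egen [RHS](reindex_inj (@perm_inj _ s)).
  apply: eq_bigr => j _; apply: eq_factor => mu; exact: symact_at_point.
pose phi : {rmorphism A n.+1 -> A n} := pi n.
rewrite -[LHS](mapcoefE phi); congr (_@_alpha).
rewrite mapcoef_egen big_ord_recr /= [X in _ * X](_ : _ = 1).
  rewrite mulr1 /egen; apply: eq_bigr => j _; apply: eq_factor => mu.
  have -> : widen_ord (leqnSn n) j = lift ord_max j.
    by apply: val_inj; rewrite /= /bump leqNgt ltn_ord.
  exact: pi_at_point.
rewrite big1 ?addr0 // => mu _.
by rewrite [phi _]pi_at_point_max monalgU0.
Qed.

Lemma ealpha_subproof alpha : ealpha_seq alpha \in @Ainf_pred R m.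
Proof.
apply/asboolP; exists [:: (wt alpha, ealpha_seq alpha)]; last by rewrite big_seq1.
by move=> p; rewrite inE => /eqP->; exact: ealpha_lim.
Qed.

Definition ealpha (alpha : {cmonom (Mplus m)}) : Ainf R m :=
  MkAinf (ealpha_subproof alpha).

(* e_k(mu): the monomial below is t_mu ^ k *)
Definition emon (k : nat) (mu : Mplus m) : Ainf R m :=
  ealpha [cmonom k | _ in fset1 mu]%M.

Definition no_constant_term (f : {malg R[{cmonom 'I_m}]}) : Prop := f@_1%M = 0.

(* e_k(f); the sum has finite support by epoly_finite_support below.          *)
Definition epoly (k : nat) (f : {malg R[{cmonom 'I_m}]}) : Ainf R m :=
  \sum_(alpha \in [set alpha : {cmonom (Mplus m)} | mdeg alpha = k])
    (\prod_(mu <- finsupp alpha) f@_(val mu) ^+ alpha mu) *: ealpha alpha.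

Lemma mdeg_ge (K : choiceType) (a : {cmonom K}) x : (a x <= mdeg a)%N.
Proof.
have [xa|/negbTE xa] := boolP (x \in finsupp a).
  by rewrite mdegE (big_fsetD1 x) //= leq_addr.
by move: (cmE_eq0 a x); rewrite xa => /eqP->.
Qed.

Lemma finite_cmonom (K : choiceType) (d : {fset K}) (k : nat) :
  finite_set [set a : {cmonom K} | mdeg a = k /\ (finsupp a `<=` d)%fset].
Proof.
pose Phi (g : {ffun d -> 'I_k.+1}) : {cmonom K} :=
  [cmonom (g x : nat) | x : d]%M.
apply: (@sub_finite_set _ _ (Phi @` [set: {ffun d -> 'I_k.+1}])); last first.
  by apply: finite_image; exact: finite_finset.
move=> a [ka ad] /=; exists [ffun x : d => inord (a (val x))] => //.
apply/eqP/cmP => x; rewrite cmE fsfun_ffun.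
case: insubP => [y xd <-|xd] /=.
  by rewrite ffunE inordK // ltnS -ka mdeg_ge.
apply/esym/eqP; rewrite cmE_eq0; apply: contra xd; exact: (fsubsetP ad).
Qed.

Lemma epoly_finite_support k (f : {malg R[{cmonom 'I_m}]}) :
  finite_set [set a : {cmonom (Mplus m)} | mdeg a = k /\
    (\prod_(mu <- finsupp a) f@_(val mu) ^+ a mu) *: ealpha a != 0 :> Ainf R m].
Proof.
pose d : {fset Mplus m} := [fset mu in pmap insub (msupp f)]%fset.
apply: sub_finite_set (finite_cmonom d k) => a [ka nz]; split=> //.
apply/fsubsetP => mu amu; rewrite /d !inE /= mem_pmap_sub.
apply: contraNT nz => /mcoeff_outdom f0.
by rewrite (big_fsetD1 mu) //= f0 expr0n cmE_eq0 amu mul0r scale0r.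
Qed.

End EAlpha.

(* Main.v *)
(* For an element x of A_R(oo,m), the coefficient of x at a monomial k depends
   only on the multiset typ k of the nontrivial columns of k, where the j-th
   column collects the exponents of x_1(j), ..., x_m(j).  Hence the e_alpha form
   an R-basis of A_R(oo,m), those with |alpha| <= n restricting to a basis in
   level n, which gives the kernel of pitilde_n as a module.

   The map (k, mu) |-> mu^k is a bijection from pairs with k > 0 and mu primitive
   onto all nontrivial monomials, and e_k(mu) has the multidegree of mu^k.  So in
   each multidegree the monomials in the proposed generators and the e_alpha are
   equally many, finitely many, and it is enough to show that the e_alpha lie in
   the subalgebra generated by the e_k(mu): a square matrix over a commutative
   ring with a one-sided inverse is invertible.  The same holds for the e_1(mu).

   Generation is triangular.  The product e_a e_b is a positive multiple of
   e_(a+b), with coefficient 1 if a and b have disjoint supports, plus shorter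
   terms; this separates different primitive roots and, over Q, reaches
   everything from the e_1(mu).  For alpha consisting of powers of a single
   primitive nu, see generation_powers.

   Over Q, the product formula puts all e_alpha with |alpha| > n in the ideal
   generated by those with |alpha| = n+1, which are recovered from the
   e_(n+1)(f) by polarization. *)
From HB Require Import structures.
Require Import Defs.
From mathcomp Require Import all_boot all_order all_algebra all_fingroup finmap.
From mathcomp Require Import boolp classical_sets.
From mathcomp Require Import monalg.
Set Implicit Arguments.
Unset Strict Implicit.
Unset Printing Implicit Defensive.
Local Open Scope ring_scope.
Local Open Scope classical_set_scope.

Import GRing.Theory.

Local Notation "'U_(' i )" := (@ucm _ i) : monom_scope.
Local Notation "1" := (@mone _) : monom_scope.
Local Notation "x * y" := (mmul x y) : monom_scope.

(** * Monomials in the x_i(j) as families of columns, and their types *)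

Section MonomialTypes.
Context {m : nat}.
Local Notation mon := {cmonom 'I_m}.
Local Notation mon2 n := {cmonom ('I_m * 'I_n)%type}.
Local Notation mtype := {cmonom (Mplus m)}.

Definition col n (k : mon2 n) (j : 'I_n) : mon :=
  [cmonom k (i, j) | i in [fset i : 'I_m | true]%fset]%M.

Definition mkcol n (f : 'I_n -> mon) : mon2 n :=
  [cmonom f p.2 p.1 | p in [fset p : 'I_m * 'I_n | true]%fset]%M.

Lemma colE n (k : mon2 n) j i : col k j i = k (i, j).
Proof. by rewrite /col cmE fsfun_fun !inE. Qed.

Lemma mkcolE n (f : 'I_n -> mon) i j : mkcol f (i, j) = f j i.
Proof. by rewrite /mkcol cmE fsfun_fun !inE. Qed.

Lemma col_mkcol n (f : 'I_n -> mon) j : col (mkcol f) j = f j.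
Proof. by apply/eqP/cmP => i; rewrite colE mkcolE. Qed.

Lemma col_inj n (k l : mon2 n) : (forall j, col k j = col l j) -> k = l.
Proof. by move=> h; apply/eqP/cmP => -[i j]; rewrite -!colE h. Qed.

Lemma mkcol_col n (k : mon2 n) : mkcol (col k) = k.
Proof. by apply: col_inj => j; rewrite col_mkcol. Qed.

Lemma colM n (k l : mon2 n) j : col (k * l)%M j = (col k j * col l j)%M.
Proof. by apply/eqP/cmP => i; rewrite cmM !colE cmM. Qed.

(* The variable t_u attached to a monomial u, with the convention t_1 = 1. *)
Definition tvar (u : mon) : mtype := if insub u is Some mu then U_(mu)%M else 1%M.

Lemma tvarE u nu : tvar u nu = (u == val nu).
Proof.
rewrite /tvar; case: insubP => [mu _ <-|]; first by rewrite cmU.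
rewrite cm1 lt0n negbK => /eqP u0; case: eqP => // e.
by move: (valP nu); rewrite /= -[Mplus_val nu]e u0.
Qed.

Lemma tvar1 : tvar 1%M = 1%M.
Proof. by rewrite /tvar insubF // mdeg1. Qed.

Lemma tvarU (mu : Mplus m) : tvar (val mu) = U_(mu)%M.
Proof. by rewrite /tvar valK. Qed.

Lemma mdeg_tvar u : mdeg (tvar u) = (u != 1%M).
Proof.
rewrite /tvar -mdeg_eq0 -lt0n; case: insubP => [mu -> _|/negbTE->]; first exact: mdegU.
exact: mdeg1.
Qed.

Lemma tvarM_triv u v : (u == 1)%M || (v == 1)%M -> tvar (u * v)%M = (tvar u * tvar v)%M.
Proof.
by case/orP => /eqP->; rewrite tvar1 ?mul1m ?mulm1.
Qed.

(** The multiset of nontrivial entries of [s], encoded by its multiplicities as an index alpha of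
    some e_alpha. *)
Definition typs (s : seq mon) : mtype := \big[mmul/1%M]_(u <- s) tvar u.

Definition typ n (k : mon2 n) : mtype := \big[mmul/1%M]_(j < n) tvar (col k j).

Lemma cm_prod (I : choiceType) (T : Type) (s : seq T) (F : T -> {cmonom I}) i :
  (\big[mmul/1%M]_(x <- s) F x) i = (\sum_(x <- s) F x i)%N.
Proof. by elim/big_rec2: _ => [|x a b _ <-]; rewrite ?cm1 ?cmM. Qed.

Lemma typsE (s : seq mon) nu : typs s nu = count_mem (val nu) s.
Proof.
rewrite cm_prod -sum1_count [RHS]big_mkcond /=; apply: eq_bigr => u _.
by rewrite tvarE; case: eqP.
Qed.

Lemma typ_typs n (k : mon2 n) : typ k = typs [seq col k j | j <- enum 'I_n].
Proof. by rewrite /typs big_map big_enum. Qed.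

Lemma typE n (k : mon2 n) nu : typ k nu = (\sum_(j < n) (col k j == val nu))%N.
Proof. by rewrite cm_prod; apply: eq_bigr => j _; rewrite tvarE. Qed.

Lemma mdeg_typ n (k : mon2 n) : mdeg (typ k) = (\sum_(j < n) (col k j != 1%M))%N.
Proof. by rewrite mdeg_prod; apply: eq_bigr => j _; rewrite mdeg_tvar. Qed.

Lemma mdeg_typ_le n (k : mon2 n) : (mdeg (typ k) <= n)%N.
Proof.
rewrite mdeg_typ -[leqRHS]card_ord -sum1_card; apply: leq_sum => j _.
by case: (_ != _).
Qed.

Lemma mdeg_typ_eq n (k : mon2 n) : mdeg (typ k) = n -> forall j, col k j != 1%M.
Proof.
move=> e j; apply/negP => /eqP c1.
suff: (mdeg (typ k) < n)%N by rewrite e ltnn.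
rewrite mdeg_typ -[leqRHS]card_ord -sum1_card (bigD1 j) //= [leqRHS](bigD1 j) //=.
rewrite c1 eqxx add0n ltnS; apply: leq_sum => i _; by case: (_ != _).
Qed.

Lemma typ_col n (k : mon2 n) j (h : (0 < mdeg (col k j))%N) :
  MkMplus h \in finsupp (typ k).
Proof.
by rewrite -cmE_neq0 typE (bigD1 j) //= eqxx.
Qed.

Lemma typ_finsupp n (k : mon2 n) nu :
  nu \in finsupp (typ k) -> exists j, col k j = val nu.
Proof.
rewrite -cmE_neq0 typE sum_nat_eq0 negb_forall => /existsP[j].
by rewrite /= eqb0 negbK => /eqP h; exists j.
Qed.

Definition permcol n (s : 'S_n) (k : mon2 n) : mon2 n := mkcol (fun j => col k (s j)).

Lemma col_permcol n (s : 'S_n) (k : mon2 n) j : col (permcol s k) j = col k (s j).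
Proof. exact: col_mkcol. Qed.

Lemma typ_permcol n (s : 'S_n) (k : mon2 n) : typ (permcol s k) = typ k.
Proof.
rewrite /typ [RHS](reindex_inj (@perm_inj _ s)); apply: eq_bigr => j _.
by rewrite col_permcol.
Qed.

Lemma mdeg_typs (s : seq mon) : mdeg (typs s) = count (predC1 1%M) s.
Proof.
rewrite mdeg_prod -sum1_count [RHS]big_mkcond /=; apply: eq_bigr => u _.
by rewrite mdeg_tvar; case: eqP.
Qed.

(** The type gives the multiplicity of every nontrivial entry; equal sizes then force the same
    number of trivial ones. *)
Lemma typs_perm (s t : seq mon) : size s = size t -> typs s = typs t -> perm_eq s t.
Proof.
move=> est e; apply/allP => u _ /=; apply/eqP.
have [u1|u1] := posnP (mdeg u).
  move: (congr1 mdeg e); rewrite (mdeg_eq0I u1) !mdeg_typs => ec.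
  by apply: (@addIn (count (predC1 1%M) s)); rewrite {2}ec !(count_predC (pred1 1%M)).
by rewrite -[u]/(val (MkMplus u1)) -!typsE e.
Qed.

(** With [typ_permcol] this identifies the S_n-orbits of monomials with the fibres of [typ]. *)
Lemma typ_perm n (k l : mon2 n) : typ k = typ l -> exists s : 'S_n, l = permcol s k.
Proof.
move=> e; pose tk := [tuple col k j | j < n]; pose tl := [tuple col l j | j < n].
have /tuple_permP[s hs] : perm_eq tl tk.
  by apply: typs_perm; rewrite ?size_tuple //= -!typ_typs.
exists s; apply: col_inj => j; rewrite col_permcol.
have : tl = [tuple tnth tk (s i) | i < n] by apply: val_inj.
by move/(congr1 (fun t => tnth t j)); rewrite !tnth_mktuple.
Qed.

Definition mlist (a : mtype) : seq mon :=
  flatten [seq nseq (a mu) (val mu) | mu <- finsupp a].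

Lemma size_mlist a : size (mlist a) = mdeg a.
Proof.
rewrite size_flatten /shape -map_comp sumnE big_map; apply: eq_bigr => mu _.
by rewrite /= size_nseq.
Qed.

Lemma typs_cat s t : typs (s ++ t) = (typs s * typs t)%M.
Proof. by rewrite /typs big_cat. Qed.

Lemma typs_nseq1 n : typs (nseq n 1%M) = 1%M.
Proof. by rewrite /typs big_nseq; elim: n => //= n ->; rewrite tvar1 mulm1. Qed.

Lemma typs_mlist a : typs (mlist a) = a.
Proof.
apply/eqP/cmP => nu; rewrite typsE count_flatten -map_comp sumnE big_map.
under eq_bigr do rewrite /= count_nseq /=.
have [h|h] := mdomP a nu.
  rewrite (big_fsetD1 nu) //= eqxx mul1n big_seq big1 ?addn0 // => mu.
  by rewrite in_fsetD1 => /andP[/negbTE ne _]; rewrite (inj_eq val_inj) ne.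
rewrite big_seq big1 // => mu hmu; rewrite (inj_eq val_inj).
by case: eqP => // e; rewrite -e hmu in h.
Qed.

(** The default value of [nth] pads [s] with trivial columns, so [rep n (mlist a)] is a standard
    monomial of type [a] once n is at least the length of [a]. *)
Definition rep n (s : seq mon) : mon2 n := mkcol (fun j => nth 1%M s j).

Lemma typ_rep n (s : seq mon) : (size s <= n)%N -> typ (rep n s) = typs s.
Proof.
move=> le; rewrite -[RHS]mulm1 -(typs_nseq1 (n - size s)) -typs_cat.
rewrite /typs (big_nth 1%M) size_cat size_nseq subnKC // big_mkord.
apply: eq_bigr => j _; rewrite col_mkcol nth_cat nth_nseq if_same.
by case: ltnP => // h; rewrite nth_default.
Qed.

Lemma exists_typ (a : mtype) n : (mdeg a <= n)%N -> exists k : mon2 n, typ k = a.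
Proof.
by move=> h; exists (rep n (mlist a)); rewrite typ_rep ?size_mlist // typs_mlist.
Qed.

(** Appending a trivial last column is dual to [pi] on coefficients; see [mcoeff_pi]. *)
Definition extcol n (k : mon2 n) : mon2 n.+1 :=
  mkcol (fun j => if unlift ord_max j is Some i then col k i else 1%M).

Lemma col_extcol_lift n (k : mon2 n) j : col (extcol k) (lift ord_max j) = col k j.
Proof. by rewrite col_mkcol liftK. Qed.

Lemma col_extcol_max n (k : mon2 n) : col (extcol k) ord_max = 1%M.
Proof. by rewrite col_mkcol unlift_none. Qed.

Lemma widen_lift n (j : 'I_n) : widen_ord (leqnSn n) j = lift ord_max j.
Proof. by apply: val_inj; rewrite /= /bump leqNgt ltn_ord. Qed.

Lemma wt1 : wt (1%M : mtype) = 0.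
Proof. by rewrite /wt mdom1 big_seq_fset0. Qed.

Lemma wt_prod (T : Type) (s : seq T) (F : T -> mtype) :
  wt (\big[mmul/1%M]_(x <- s) F x) = \sum_(x <- s) wt (F x).
Proof. exact: (big_morph _ (@wtM m) wt1). Qed.

Lemma wtU (mu : Mplus m) : wt U_(mu)%M = mondeg mu.
Proof. by rewrite /wt mdomU big_seq_fset1 cmUU. Qed.

Lemma wt_tvar u i : wt (tvar u) i = u i.
Proof.
rewrite /tvar; case: insubP => [mu _ <-|].
  by rewrite wtU ffunE.
by rewrite wt1 -eqn0Ngt => /eqP/mdeg_eq0I->; rewrite cm1 ffunE.
Qed.

Lemma wt_typ n (k : mon2 n) : wt (typ k) = multidegree k.
Proof.
apply/ffunP => i; rewrite wt_prod sum_ffunE ffunE; apply: eq_bigr => j _.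
by rewrite wt_tvar colE.
Qed.

End MonomialTypes.

(** * The coefficients of the e_alpha *)

Section Coefficients.
Context {R : comNzRingType} {m : nat}.
Local Notation mon := {cmonom 'I_m}.
Local Notation mon2 n := {cmonom ('I_m * 'I_n)%type}.
Local Notation mtype := {cmonom (Mplus m)}.
Local Notation A n := (Apoly R n m).

Lemma monomM (S : comNzRingType) (K : choiceType) (c d : S) (a b : {cmonom K}) :
  << c *g a >> * << d *g b >> = << c * d *g (a * b)%M >> :> {malg S[{cmonom K}]}.
Proof. by rewrite malgM_def fgmulUU. Qed.

Lemma monom_prod (S : comNzRingType) (K : choiceType) (T : Type) (s : seq T)
    (c : T -> S) (F : T -> {cmonom K}) :
  \prod_(x <- s) << c x *g F x >> =
  << \prod_(x <- s) c x *g \big[mmul/1%M]_(x <- s) F x >> :> {malg S[{cmonom K}]}.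
Proof.
elim/big_rec3: _ => [|x a b c' _ ->]; first by [].
by rewrite monomM.
Qed.

Lemma monom_prod1 (S : comNzRingType) (K : choiceType) (T : Type) (s : seq T)
    (F : T -> {cmonom K}) :
  \prod_(x <- s) << F x >> = << \big[mmul/1%M]_(x <- s) F x >> :> {malg S[{cmonom K}]}.
Proof. by rewrite monom_prod big1_eq. Qed.

Lemma expcmnS (K : choiceType) (a : {cmonom K}) e :
  expcmn a e.+1 = (a * expcmn a e)%M.
Proof. by case: e => [|e] //=; rewrite [RHS]mulm1. Qed.

Lemma expcmnE (K : choiceType) (a : {cmonom K}) e i : expcmn a e i = (a i * e)%N.
Proof.
elim: e => [|e IH]; first by rewrite muln0 [LHS]cm1.
by rewrite expcmnS cmM IH mulnS.
Qed.

Lemma monomX (S : comNzRingType) (K : choiceType) (a : {cmonom K}) e :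
  << a >> ^+ e = << expcmn a e >> :> {malg S[{cmonom K}]}.
Proof.
elim: e => [|e IH]; first by [].
rewrite exprS IH monomM expcmnS; congr << _ *g _ >>; exact: mulr1.
Qed.

Definition onecol n (j : 'I_n) (u : mon) : mon2 n :=
  mkcol (fun i => if i == j then u else 1%M).

Lemma at_point_onecol n (j : 'I_n) (u : mon) :
  at_point j << u >> = << onecol j u >> :> A n.
Proof.
rewrite at_pointU /cmval /xvar; under eq_bigr do rewrite monomX.
rewrite monom_prod1; apply: (congr1 (mkmalgU^~ _)); apply/eqP/cmP => -[i l].
rewrite cm_prod mkcolE; under eq_bigr do rewrite expcmnE cmU xpair_eqE.
case: (eqVneq l j) => [_|ne].
  have [h|h] := mdomP u i.
    rewrite (big_fsetD1 i) //= !eqxx mul1n big_seq big1 ?addn0 // => i'.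
    by rewrite in_fsetD1 => /andP[/negbTE-> _]; rewrite mul0n.
  rewrite big_seq big1 // => i' hi'; case: eqP => [e|]; last by rewrite mul0n.
  by rewrite -e hi' in h.
by rewrite cm1 big1 // => i' _; rewrite andbF mul0n.
Qed.

Lemma big_onecol n (f : 'I_n -> mon) :
  \big[mmul/1%M]_(j < n) onecol j (f j) = mkcol f.
Proof.
apply/eqP/cmP => -[i l]; rewrite cm_prod mkcolE (bigD1 l) //= big1 => [|j ne].
  by rewrite mkcolE eqxx addn0.
by rewrite mkcolE eq_sym (negbTE ne) cm1.
Qed.

Lemma onecol1 n (j : 'I_n) : onecol j 1%M = 1%M.
Proof. by apply/eqP/cmP => -[i l]; rewrite mkcolE if_same !cm1. Qed.

(** Expanding the generating product means choosing a column for each j. The choice yielding k is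
    unique, namely the columns of k, and it carries the t-monomial [typ k]. *)
Lemma mcoeff_ealpha_seq (alpha : mtype) n (k : mon2 n) :
  (@ealpha_seq R m alpha n)@_k = (typ k == alpha)%:R.
Proof.
rewrite /ealpha_seq /egen; set d := finsupp alpha.
(* Adjoining the trivial monomial absorbs the summand 1, so each factor becomes one sum over [us]
   and the product can be distributed. *)
pose us : {fset mon} := (1%M |` [fset val mu | mu in d])%fset.
pose G (j : 'I_n) (u : mon) : {malg (A n)[{cmonom Mplus m}]} :=
  << at_point j << u >> *g tvar u >>.
have facE (j : 'I_n) : 1 + \sum_(mu <- d) << at_point j << val mu >> *g U_(mu)%M >>
    = \sum_(u : us) G j (val u).
  rewrite -(big_seq_fsetE _ us xpredT (G j)) /= big_fsetU1 /=; last first.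
    apply/negP => /imfsetP[mu _ /= e]; move: (valP mu).
    by rewrite /= -[Mplus_val mu]e mdeg1.
  have -> : G j 1%M = 1 by rewrite /G tvar1 at_point_onecol onecol1.
  apply: (congr1 (+%R 1)); rewrite big_imfset /=; last by move=> x y _ _; exact: val_inj.
  by apply: eq_bigr => mu _; rewrite /G tvarU.
under eq_bigr => j _ do rewrite facE.
rewrite bigA_distr_bigA /=.
have termE (f : {ffun 'I_n -> us}) : \prod_(j < n) G j (val (f j)) =
    << << mkcol (fun j => val (f j)) >> *g typ (mkcol (fun j => val (f j))) >>.
  rewrite /G monom_prod; apply: (congr2 (fun x y => << x *g y >>)).
    under eq_bigr do rewrite at_point_onecol.
    by rewrite monom_prod1 big_onecol.
  by apply: eq_bigr => j _; rewrite col_mkcol.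
under eq_bigr do rewrite termE.
rewrite !raddf_sum /=; under eq_bigr do rewrite mcoeffU raddfMn /= mcoeffU1.
have [e|ne] := eqVneq (typ k) alpha; last first.
  rewrite big1 // => f _; case: eqP => [ek|]; last by rewrite mul0rn.
  by rewrite ek (negbTE ne).
have us_col j : col k j \in us.
  rewrite in_fset1U; apply/orP; have [/mdeg_eq0I->|h] := posnP (mdeg (col k j)).
    by left.
  by right; apply/imfsetP; exists (MkMplus h); rewrite //= /d -e typ_col.
pose f0 : {ffun 'I_n -> us} := [ffun j => [` us_col j]%fset].
have f0E : mkcol (fun j => val (f0 j)) = k.
  by apply: col_inj => j; rewrite col_mkcol ffunE.
rewrite (bigD1 f0) //= f0E e !eqxx big1 ?addr0 // => f /eqP ne.
case: eqP => [ek|]; last by rewrite mul0rn.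
case: ne; apply/ffunP => j; apply: val_inj.
by rewrite ffunE /= -ek col_mkcol.
Qed.

End Coefficients.

(** * Coordinates in the basis of the e_alpha, and the kernel as a module *)

Section Coordinates.
Context {R : comNzRingType} {m : nat}.
Local Notation mon := {cmonom 'I_m}.
Local Notation mon2 n := {cmonom ('I_m * 'I_n)%type}.
Local Notation mtype := {cmonom (Mplus m)}.
Local Notation A n := (Apoly R n m).
Local Notation deg := {ffun 'I_m -> nat}.

Lemma monom_at_point n (c : R) (k : mon2 n) :
  << c *g k >> = c *: \prod_(j < n) at_point j << col k j >> :> A n.
Proof.
under eq_bigr do rewrite at_point_onecol.
rewrite monom_prod1 big_onecol mkcol_col; apply/malgP => l.
by rewrite mcoeffZ [LHS]mcoeffU [X in c * X]mcoeffU1 mulr_natr.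
Qed.

Lemma at_point_mkcol n (f : 'I_n -> mon) :
  \prod_(j < n) at_point j << f j >> = << mkcol f >> :> A n.
Proof.
by under eq_bigr do rewrite at_point_onecol; rewrite monom_prod1 big_onecol.
Qed.

(** The action moves column j to column s(j), so the only monomial sent to k is the one whose column
    j is column s(j) of k. *)
Lemma mcoeff_symact n (s : 'S_n) (p : A n) k :
  (symact s p)@_k = p@_(permcol s k).
Proof.
rewrite [in LHS](monalgE p) [in RHS](monalgE p) (linear_sum (symact s)) !raddf_sum /=.
apply: eq_bigr => l _; rewrite mcoeffU [X in symact s X]monom_at_point (linearZ_LR (symact s)) /=.
rewrite (rmorph_prod (symact s)) mcoeffZ (reindex_inj (@perm_inj _ s^-1%g)) /=.
under eq_bigr do rewrite symact_at_point permKV.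
rewrite (at_point_mkcol (fun j => col l ((s^-1)%g j))) mcoeffU1 mulr_natr.
congr (_ *+ _); apply: congr1; apply/eqP/eqP => [<-|->].
  by apply: col_inj => j; rewrite col_permcol col_mkcol permK.
by apply: col_inj => j; rewrite col_mkcol col_permcol permKV.
Qed.

(** Monomials with a nontrivial last column are killed; the others merely lose that trivial
    column. *)
Lemma mcoeff_pi n (p : A n.+1) (k : mon2 n) : (Defs.pi n p)@_k = p@_(extcol k).
Proof.
rewrite [in LHS](monalgE p) [in RHS](monalgE p) (linear_sum (Defs.pi n)) !raddf_sum /=.
apply: eq_bigr => l _; rewrite mcoeffU [X in Defs.pi n X]monom_at_point (linearZ_LR (Defs.pi n)) /=.
rewrite (rmorph_prod (Defs.pi n)) mcoeffZ big_ord_recr /=.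
under eq_bigr do rewrite widen_lift pi_at_point.
have [/mdeg_eq0I e|h] := posnP (mdeg (col l ord_max)); last first.
  rewrite [Defs.pi n _](pi_at_point_max n (MkMplus h)) mulr0 mcoeff0 mulr0.
  case: eqP => // e; move: h; by rewrite e col_extcol_max mdeg1.
have -> : Defs.pi n (at_point ord_max << col l ord_max >>) = 1 :> A n by rewrite e !rmorph1.
rewrite mulr1.
rewrite (at_point_mkcol (fun j => col l (lift ord_max j))) mcoeffU1 mulr_natr.
congr (_ *+ _); apply: congr1; apply/eqP/eqP => [<-|->].
  apply: col_inj => j; case: (unliftP ord_max j) => [i ->|->].
    by rewrite col_extcol_lift col_mkcol.
  by rewrite col_extcol_max.
by apply: col_inj => j; rewrite col_mkcol col_extcol_lift.
Qed.

(* By symmetry and compatibility with the pi_n, the coefficient of x at a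
   monomial k depends only on typ k (mcoeff_cf). *)
Definition cf (a : mtype) (x : Ainf R m) : R :=
  (val x (mdeg a))@_(rep (mdeg a) (mlist a)).

Lemma cf_is_linear a : linear_for *%R (cf a).
Proof. by move=> c x y; rewrite /cf mcoeffD mcoeffZ. Qed.

HB.instance Definition _ a :=
  GRing.isLinear.Build R (Ainf R m) R *%R (cf a) (cf_is_linear a).

Lemma Ainf_compat (x : Ainf R m) n : Defs.pi n (val x n.+1) = val x n.
Proof.
case: x => f /= /asboolP[s hs ->]; rewrite !Aseq_sumE (linear_sum (Defs.pi n)) big_seq [RHS]big_seq.
by apply: eq_bigr => p /hs[_].
Qed.

Lemma extcol_rep n (s : seq mon) : (size s <= n)%N -> extcol (rep n s) = rep n.+1 s.
Proof.
move=> h; apply: col_inj => j; case: (unliftP ord_max j) => [i ->|->].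
  by rewrite col_extcol_lift !col_mkcol lift_max.
by rewrite col_extcol_max col_mkcol nth_default.
Qed.

Lemma mcoeff_cf (x : Ainf R m) n (k : mon2 n) : (val x n)@_k = cf (typ k) x.
Proof.
set a := typ k; have le_an : (mdeg a <= n)%N := mdeg_typ_le k.
have -> : (val x n)@_k = (val x n)@_(rep n (mlist a)).
  have [s ->] : exists s : 'S_n, k = permcol s (rep n (mlist a)).
    by apply: typ_perm; rewrite typ_rep ?size_mlist // typs_mlist.
  by rewrite -mcoeff_symact; move: (asboolP _ (Ainf_invariant x n)) => ->.
(* Descend from level n to the length of [a], deleting one trivial column at a time by compatibility
   with [pi]. *)
rewrite /cf -(subnKC le_an); elim: (n - _)%N => [|d IH]; first by rewrite addn0.
by rewrite -{}IH addnS -[in RHS]Ainf_compat mcoeff_pi extcol_rep ?size_mlist ?leq_addr.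
Qed.

Lemma cfP (x y : Ainf R m) : (forall a, cf a x = cf a y) -> x = y.
Proof.
move=> h; apply: val_inj; apply: AseqP => n; apply/malgP => k.
by rewrite !mcoeff_cf.
Qed.

Lemma cf_ealpha a b : cf b (ealpha a) = (a == b)%:R.
Proof.
by rewrite /cf mcoeff_ealpha_seq typ_rep ?size_mlist // typs_mlist eq_sym.
Qed.

Lemma cf_wt x w a : limA w (val x) -> cf a x != 0 -> wt a = w.
Proof.
move=> [hx _]; rewrite /cf => nz; case: (hx (mdeg a)) => /(_ (rep (mdeg a) (mlist a))) h _.
by rewrite -h -?wt_typ ?typ_rep ?size_mlist ?typs_mlist // -mcoeff_neq0.
Qed.

Lemma mdegT (T : finType) (k : {cmonom T}) : mdeg k = (\sum_(x : T) k x)%N.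
Proof.
rewrite (mdegEw (d := [fset x : T | true]%fset)); last first.
  by apply/fsubsetP => x; rewrite !inE.
apply: perm_big; apply: uniq_perm; rewrite ?index_enum_uniq ?fset_uniq //.
by move=> x; rewrite mem_index_enum !inE.
Qed.

Lemma mdeg_multidegree n (k : mon2 n) : mdeg k = (\sum_i multidegree k i)%N.
Proof.
rewrite mdegT [RHS](eq_bigr _ (fun i _ => ffunE _ i)) pair_bigA /=.
by apply: eq_bigr => -[].
Qed.

(** Every nontrivial column has degree at least 1. *)
Lemma mdeg_le_wt (a : mtype) : (mdeg a <= \sum_i wt a i)%N.
Proof.
have [k <-] := exists_typ (leqnn (mdeg a)).
rewrite wt_typ mdeg_typ; under [leqRHS]eq_bigr do rewrite ffunE.
rewrite exchange_big /=.
apply: leq_sum => j _; under [leqRHS]eq_bigr do rewrite -colE.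
by rewrite -mdegT -mdeg_eq0; case: (mdeg _).
Qed.

(** By [mdeg_le_wt] each such type is realized with N columns, by one of the finitely many monomials
    of degree N. *)
Lemma finite_wt w : cardinality.finite_set [set a : mtype | wt a = w].
Proof.
pose N := (\sum_i w i)%N.
apply: (@cardinality.sub_finite_set _ _ [set typ k | k in [set k : mon2 N |
  mdeg k = N /\ (finsupp k `<=` [fset p : 'I_m * 'I_N | true])%fset]]); last first.
  by apply: cardinality.finite_image; exact: finite_cmonom.
move=> a /= wa; have [k ka] : exists k : mon2 N, typ k = a.
  by apply: exists_typ; rewrite /N -wa mdeg_le_wt.
exists k => //; split; first by rewrite mdeg_multidegree -wt_typ ka wa.
by apply/fsubsetP => p; rewrite !inE.
Qed.

Definition wtset (w : deg) : {fset mtype} := cardinality.fset_set [set a : mtype | wt a = w].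

Lemma in_wtset w a : (a \in wtset w) = (wt a == w).
Proof.
rewrite /wtset cardinality.in_fset_set; last exact: finite_wt.
by apply/idP/eqP; rewrite inE.
Qed.

Lemma cf_sum (T : Type) (s : seq T) (F : T -> Ainf R m) a :
  cf a (\sum_(i <- s) F i) = \sum_(i <- s) cf a (F i).
Proof. exact: raddf_sum. Qed.

Lemma cf_finite x : exists D : {fset mtype}, forall a, cf a x != 0 -> a \in D.
Proof.
case: x => f hf; have [s hs fE] := asboolP _ hf.
exists (\bigcup_(p <- s) wtset p.1)%fset => a.
rewrite /cf /= fE Aseq_sumE raddf_sum /= => nz.
have [p ps pnz] : exists2 p, p \in s &
    (p.2 (mdeg a))@_(rep (mdeg a) (mlist a)) != 0.
  apply/hasP; apply: contraNT nz => /hasPn h; rewrite big_seq big1 // => p /h.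
  by rewrite negbK => /eqP.
apply/bigfcupP; exists p; rewrite ?ps // in_wtset.
have hp : p.2 \in @Ainf_pred R m.
  by apply/asboolP; exists [:: p]; rewrite ?big_seq1 // => q; rewrite inE => /eqP->; exact: hs.
by apply/eqP; apply: (@cf_wt (MkAinf hp)) => //; exact: hs.
Qed.

Lemma cf_expand x (D : {fset mtype}) : (forall a, cf a x != 0 -> a \in D) ->
  x = \sum_(a <- D) cf a x *: ealpha a.
Proof.
move=> h; apply: cfP => b; rewrite cf_sum.
have E a : cf b (cf a x *: ealpha a) = cf a x * (a == b)%:R.
  by rewrite linearZ /= cf_ealpha.
under eq_bigr do rewrite E; have [bD|/negP bD] := boolP (b \in D).
  rewrite (big_fsetD1 b) //= eqxx mulr1 big_seq big1 ?addr0 // => a.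
  by rewrite in_fsetD1 => /andP[/negbTE-> _]; rewrite mulr0.
have -> : cf b x = 0 by apply/eqP/negPn/negP => /h.
rewrite big_seq big1 // => a aD; case: eqP => [e|_]; last by rewrite mulr0.
by rewrite e in aD.
Qed.

(** The types occurring among monomials of level n are exactly those of length at most n. *)
Lemma pitilde_eq0 n x : pitilde n x = 0 <-> forall a, (mdeg a <= n)%N -> cf a x = 0.
Proof.
split=> [e a /exists_typ[k <-]|h].
  by rewrite -mcoeff_cf; move/(congr1 val): e => /= ->; rewrite mcoeff0.
apply: val_inj; apply/malgP => k.
by rewrite /= mcoeff0 [LHS]mcoeff_cf h // mdeg_typ_le.
Qed.

Lemma kernel_module_span n (x : Ainf R m) : pitilde n x = 0 <->
  module_span [set ealpha alpha | alpha in
    [set alpha : mtype | exists2 k : nat, (1 <= k)%N & mdeg alpha = (n + k)%N]] x.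
Proof.
rewrite pitilde_eq0; split=> [h|[s hs ->] a le_an]; last first.
  rewrite cf_sum big_seq big1 // => p /hs [b [k k1 bk] <-].
  rewrite linearZ /= cf_ealpha; case: eqP => [e|_]; last by rewrite mulr0.
  by move: le_an; rewrite -e bk -[X in (_ <= X)%N]addn0 leq_add2l leqNgt k1.
have [D hD] := cf_finite x.
exists [seq (cf a x, ealpha a) | a <- [fset a in D | (n < mdeg a)%N]%fset].
  move=> p /mapP[a]; rewrite !inE => /andP[_ na] ->; exists a => //.
  by exists (mdeg a - n)%N; rewrite ?subn_gt0 // subnKC // ltnW.
rewrite big_map /=; apply: cf_expand => a nz; rewrite !inE /= hD //= ltnNge.
by apply: contra nz => /h ->.
Qed.

End Coordinates.

(** * From generation to free generation *)

Section FreeGeneration.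
Context {R : comNzRingType} {m : nat}.
Local Notation mtype := {cmonom (Mplus m)}.
Local Notation deg := {ffun 'I_m -> nat}.

Lemma limAX (w : deg) (x : Ainf R m) e :
  limA w (val x) -> limA (w *+ e) (val (x ^+ e)).
Proof.
move=> h; elim: e => [|e IH]; first by rewrite expr0; exact: limA1.
by rewrite exprS mulrS; exact: (limAM h IH).
Qed.

Lemma pevalE (I : choiceType) (B : comAlgType R) (v : I -> B) p :
  peval v p = \sum_(k <- msupp p) p@_k *: cmval v k.
Proof. by rewrite /peval mmapE; apply: eq_bigr => k _; rewrite mulr_algl. Qed.

Lemma peval_monom (I : choiceType) (p : {malg R[{cmonom I}]}) :
  peval (fun i => << U_(i)%M >>) p = p.
Proof.
rewrite pevalE [RHS]monalgE; apply: eq_bigr => k _.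
rewrite /cmval; under eq_bigr do rewrite monomX.
rewrite monom_prod1 (_ : \big[_/_]_(_ <- _) _ = k).
  by apply/malgP => l; rewrite mcoeffZ [X in _ * X]mcoeffU1 [RHS]mcoeffU mulr_natr.
apply/eqP/cmP => i; rewrite cm_prod; under eq_bigr do rewrite expcmnE cmU.
have [h|h] := mdomP k i.
  rewrite (big_fsetD1 i) //= eqxx mul1n big_seq big1 ?addn0 // => j.
  by rewrite in_fsetD1 => /andP[/negbTE-> _]; rewrite mul0n.
rewrite big_seq big1 // => j hj; case: eqP => [e|]; last by rewrite mul0n.
by rewrite -e hj in h.
Qed.

(** Indexing by all nontrivial monomials, with [g mu] of the multidegree of mu, makes a monomial in
    the generators and the e_alpha with the same index homogeneous of the same weight. *)
Variable g : Mplus m -> Ainf R m.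
Hypothesis g_wt : forall mu, limA (mondeg mu) (val (g mu)).
Hypothesis g_gen : forall a, exists p, peval g p = ealpha a.

Lemma limA_cmval (k : mtype) : limA (wt k) (val (cmval g k)).
Proof.
rewrite /wt /cmval; elim/big_rec2: _ => [|mu w x _ h]; first exact: limA1.
exact: (limAM (limAX (k mu) (g_wt mu)) h).
Qed.

(** Homogeneity kills the contributions of all other weights, which reduces the question to finite
    matrices. *)
Lemma cf_peval (b : mtype) p :
  cf b (peval g p) = \sum_(k <- wtset (wt b)) p@_k * cf b (cmval g k).
Proof.
rewrite pevalE cf_sum; under eq_bigr do rewrite linearZ /=.
rewrite (big_fset_incl _ (fsubsetUl (msupp p) (wtset (wt b)))) /=; last first.
  by move=> k _ /mcoeff_outdom->; rewrite mul0r.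
rewrite [RHS](big_fset_incl _ (fsubsetUr (msupp p) (wtset (wt b)))) //=.
move=> k _; rewrite in_wtset => ne.
suff -> : cf b (cmval g k) = 0 by rewrite mulr0.
by apply/eqP; apply: contraNT ne => /(cf_wt (limA_cmval k))->.
Qed.

(* In each multidegree w the monomials in the g mu and the e_alpha are indexed
   by the same finite set, so the matrix M expressing the former through the
   latter is square; it has a left inverse by g_gen. *)
Lemma peval_inj p : peval g p = 0 -> p = 0.
Proof.
move=> p0; apply/malgP => b; rewrite mcoeff0.
pose D := wtset (wt b); pose v (i : 'I_#|{: D}|) : mtype := val (enum_val i).
have vw i : wt (v i) = wt b.
  by apply/eqP; rewrite -in_wtset /v; exact: valP.
have sumD (F : mtype -> R) : \sum_(k <- D) F k = \sum_i F (v i).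
  by rewrite big_seq_fsetE /= -(big_enum_val (fun x => F (val x))).
pose q a := projT1 (cid (g_gen a)).
have qE a : peval g (q a) = ealpha a := projT2 (cid (g_gen a)).
pose M := \matrix_(i, j) cf (v j) (cmval g (v i)).
pose P := \matrix_(i, j) (q (v i))@_(v j).
(* Row i of P lists the coefficients of a polynomial expressing the i-th e_alpha through the
   generators. *)
have PM : P *m M = 1%:M.
  apply/matrixP => i l; rewrite !mxE.
  transitivity (cf (v l) (peval g (q (v i)))).
    by rewrite cf_peval vw sumD; apply: eq_bigr => j _; rewrite !mxE.
  by rewrite qE cf_ealpha /v !(inj_eq val_inj) (inj_eq enum_val_inj).
pose rp : 'rV_#|{: D}| := \row_j p@_(v j).
have rpM : rp *m M = 0.
  apply/matrixP => i l; rewrite !mxE; transitivity (cf (v l) (peval g p)).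
    by rewrite cf_peval vw sumD; apply: eq_bigr => j _; rewrite !mxE.
  by rewrite p0 raddf0.
(* For square matrices over a commutative ring, [mulmx1C] makes the left inverse a right inverse. *)
have rp0 : rp = 0 by rewrite -[rp]mulmx1 -(mulmx1C PM) mulmxA rpM mul0mx.
have bD : b \in D by rewrite in_wtset.
have := congr1 (fun r : 'rV_#|{: D}| => r 0 (enum_rank [` bD]%fset)) rp0.
by rewrite !mxE /v enum_rankK.
Qed.

Lemma peval_surj y : exists p, peval g p = y.
Proof.
have [D hD] := cf_finite y; rewrite (cf_expand hD).
exists (\sum_(a <- D) cf a y *: projT1 (cid (g_gen a))).
rewrite (linear_sum (peval g)); apply: eq_bigr => a _.
by rewrite [LHS](linearZ_LR (peval g)); case: cid => q /= ->.
Qed.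

Lemma peval_bij : freely_generated g.
Proof.
exists (fun y => projT1 (cid (peval_surj y))) => [p|y]; case: cid => q //= hq.
apply/eqP; rewrite -subr_eq0; apply/eqP; apply: peval_inj.
by rewrite [LHS](linearB (peval g)) /= hq subrr.
Qed.

End FreeGeneration.

(** This passes from generators indexed by [Mplus m], as in [peval_bij], to pairs of an exponent and
    a primitive monomial. *)
Lemma freely_generated_reindex (R : comNzRingType) (B : comAlgType R)
    (I J : choiceType) (h : I -> J) (g : J -> B) :
  bijective h -> freely_generated g -> freely_generated (g \o h).
Proof.
move=> [h' hK h'K] bg.
pose X (K L : choiceType) (k : K -> L) (p : {malg R[{cmonom K}]}) : {malg R[{cmonom L}]} :=
  peval (fun i => << U_(k i)%M >>) p.
have XX (K L : choiceType) (k : K -> L) (C : comAlgType R) (u : L -> C) p :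
    peval u (X K L k p) = peval (u \o k) p.
  rewrite /X (lrmorph_peval (peval u : {lrmorphism _ -> _})).
  by apply: (congr1 (fun v => peval v p)); apply/funext => i; rewrite /= pevalX.
have XK (K L : choiceType) (k : K -> L) (k' : L -> K) : cancel k k' -> cancel (X K L k) (X L K k').
  move=> kK p; rewrite [LHS]XX -[RHS]peval_monom.
  by apply: (congr1 (fun v => peval v p)); apply/funext => i; rewrite /= kK.
apply: (@eq_bij _ _ (peval g \o X _ _ h)); last by move=> p; exact: XX.
by apply: bij_comp => //; exists (X _ _ h'); exact: XK.
Qed.

(** * Structure constants of the products e_a e_b *)

Section Products.
Context {R : comNzRingType} {m : nat}.
Local Notation mon2 n := {cmonom ('I_m * 'I_n)%type}.
Local Notation mtype := {cmonom (Mplus m)}.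
Local Notation ealpha := (@ealpha R m).
Local Notation cf := (@cf R m).

Lemma mem_msupp_ealpha (a : mtype) n (k : mon2 n) :
  (k \in msupp (@ealpha_seq R m a n)) = (typ k == a).
Proof.
by rewrite -mcoeff_neq0 mcoeff_ealpha_seq; case: (_ == a); rewrite ?oner_neq0 ?eqxx.
Qed.

Lemma cmMI (I : choiceType) (a b c : {cmonom I}) : (a * b)%M = (a * c)%M -> b = c.
Proof.
move=> e; apply/eqP/cmP => i; apply: (@addnI (a i)).
by rewrite -!cmM e.
Qed.

(** The structure constant counts the factorizations of k into monomials of types [a] and [b]. *)
Lemma cf_mulE (a b : mtype) n (k : mon2 n) :
  cf (typ k) (ealpha a * ealpha b) =
  (\sum_(k1 <- msupp (@ealpha_seq R m a n)) \sum_(k2 <- msupp (@ealpha_seq R m b n))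
     ((k1 * k2)%M == k))%:R.
Proof.
rewrite -mcoeff_cf [LHS]mcoeffMl natr_sum big_seq [RHS]big_seq.
apply: eq_bigr => k1; rewrite mem_msupp_ealpha => /eqP e1.
rewrite natr_sum big_seq [RHS]big_seq.
apply: eq_bigr => k2; rewrite mem_msupp_ealpha => /eqP e2.
by rewrite !mcoeff_ealpha_seq e1 e2 !eqxx mul1r.
Qed.

Lemma cf_mul_neq0 (a b c : mtype) : cf c (ealpha a * ealpha b) != 0 ->
  exists k1 k2 : mon2 (mdeg c), [/\ typ k1 = a, typ k2 = b & typ (k1 * k2)%M = c].
Proof.
have [k kc] := exists_typ (leqnn (mdeg c)); rewrite -{1}kc cf_mulE => nz.
have : has (fun k1 => has (fun k2 => (k1 * k2)%M == k)
    (msupp (@ealpha_seq R m b (mdeg c)))) (msupp (@ealpha_seq R m a (mdeg c))).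
  apply: contraNT nz => /hasPn h; rewrite [X in X%:R](_ : _ = 0%N) ?eqxx //.
  rewrite big_seq; apply: big1 => k1 /h /hasPn h2.
  by rewrite big_seq; apply: big1 => k2 /h2 /negbTE ->.
case/hasP => k1; rewrite mem_msupp_ealpha => /eqP e1 /hasP[k2].
by rewrite mem_msupp_ealpha => /eqP e2 /eqP e; exists k1, k2; rewrite e.
Qed.

Lemma cf_mul_pos n (k1 k2 : mon2 n) : exists2 c : nat, (0 < c)%N &
  cf (typ (k1 * k2)%M) (ealpha (typ k1) * ealpha (typ k2)) = c%:R.
Proof.
rewrite cf_mulE; eexists; last by [].
rewrite (big_fsetD1 k1) ?mem_msupp_ealpha //= (big_fsetD1 k2) ?mem_msupp_ealpha //=.
by rewrite eqxx.
Qed.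

(** Once the first factor is determined, cancellation determines the second, so there is one
    factorization to count. *)
Lemma cf_mul_uniq n (k1 k2 : mon2 n) :
  (forall l1 l2, typ l1 = typ k1 -> typ l2 = typ k2 ->
     (l1 * l2)%M = (k1 * k2)%M -> l1 = k1) ->
  cf (typ (k1 * k2)%M) (ealpha (typ k1) * ealpha (typ k2)) = 1.
Proof.
move=> u; rewrite cf_mulE; set c := (X in X%:R); suff -> : c = 1%N by []; rewrite /c.
rewrite (big_fsetD1 k1) ?mem_msupp_ealpha //= (big_fsetD1 k2) ?mem_msupp_ealpha //=.
rewrite [X in (_ + X + _)%N](_ : _ = 0%N); last first.
  apply: big1_seq => l2 /=; rewrite in_fsetD1 => /andP[/eqP ne _].
  by apply/eqP; rewrite eqb0; apply/negP => /eqP /cmMI /ne.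
rewrite [X in (_ + X)%N](_ : _ = 0%N) ?eqxx //.
apply: big1_seq => l1 /=; rewrite in_fsetD1 mem_msupp_ealpha => /andP[/eqP ne /eqP e1].
apply: big1_seq => l2 /=; rewrite mem_msupp_ealpha => /eqP e2.
by apply/eqP; rewrite eqb0; apply/negP => /eqP /(u _ _ e1 e2) /ne.
Qed.

Lemma col1_sum n (k1 k2 : mon2 n) :
  (mdeg (typ k1) + mdeg (typ k2) = \sum_(j < n) ((col k1 j != 1%M) + (col k2 j != 1%M)))%N.
Proof. by rewrite !mdeg_typ big_split. Qed.

(** A column nontrivial in both factors counts twice on the right but only once on the left. *)
Lemma mdeg_typM n (k1 k2 : mon2 n) :
  (mdeg (typ (k1 * k2)%M) < mdeg (typ k1) + mdeg (typ k2))%N \/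
  forall j, col k1 j = 1%M \/ col k2 j = 1%M.
Proof.
have [/forallP h|] := boolP [forall j, (col k1 j == 1%M) || (col k2 j == 1%M)].
  by right=> j; case/orP: (h j) => /eqP; [left|right].
rewrite negb_forall => /existsP[j]; rewrite negb_or => /andP[h1 h2]; left.
rewrite col1_sum mdeg_typ (bigD1 j) //= [ltnRHS](bigD1 j) //= h1 h2.
rewrite -addSn leq_add //; first by case: (_ != _).
apply: leq_sum => i _; rewrite colM cmM_eq1.
by case: (_ == _); case: (_ == _).
Qed.

Lemma typM n (k1 k2 : mon2 n) : (forall j, col k1 j = 1%M \/ col k2 j = 1%M) ->
  typ (k1 * k2)%M = (typ k1 * typ k2)%M.
Proof.
move=> h; rewrite /typ -big_split /=; apply: eq_bigr => j _.
by rewrite colM tvarM_triv //; case: (h j) => ->; rewrite eqxx ?orbT.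
Qed.

Lemma cf_mul_length (a b c : mtype) : cf c (ealpha a * ealpha b) != 0 ->
  c = (a * b)%M \/ (mdeg c < mdeg a + mdeg b)%N.
Proof.
case/cf_mul_neq0 => k1 [k2 [e1 e2 e]].
by case: (mdeg_typM k1 k2) => [|/typM]; rewrite e e1 e2; [right|left].
Qed.

Lemma exists_typM (a b : mtype) : exists k1 k2 : mon2 (mdeg a + mdeg b),
  [/\ typ k1 = a, typ k2 = b & typ (k1 * k2)%M = (a * b)%M].
Proof.
pose k1 : mon2 (mdeg a + mdeg b) := rep _ (mlist a).
(* The leading trivial columns shift [b] past the columns occupied by [a]. *)
pose k2 : mon2 (mdeg a + mdeg b) := rep _ (nseq (mdeg a) 1%M ++ mlist b).
have e1 : typ k1 = a by rewrite typ_rep ?size_mlist ?leq_addr // typs_mlist.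
have e2 : typ k2 = b.
  by rewrite typ_rep ?size_cat ?size_nseq ?size_mlist // typs_cat typs_nseq1 mul1m typs_mlist.
exists k1, k2; split=> //; rewrite typM ?e1 ?e2 // => j; rewrite !col_mkcol.
rewrite nth_cat size_nseq nth_nseq; case: ltnP => h; [by right|left].
by rewrite nth_default // size_mlist.
Qed.

Lemma cf_mul_top (a b : mtype) : exists2 c : nat, (0 < c)%N &
  cf (a * b)%M (ealpha a * ealpha b) = c%:R.
Proof.
have [k1 [k2 [e1 e2 e]]] := exists_typM a b.
by move: (cf_mul_pos k1 k2); rewrite e e1 e2.
Qed.

Lemma typ_col_disj (a b : mtype) n (k l : mon2 n) j :
  [disjoint finsupp a & finsupp b]%fset -> typ k = a -> typ l = b ->
  col k j = col l j -> col k j = 1%M.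
Proof.
move=> dab ka lb e; have [/mdeg_eq0I //|h] := posnP (mdeg (col k j)).
have ha := typ_col h; move: h ha; rewrite e => h ha; have := typ_col h.
rewrite lb => hb; rewrite ka in ha.
by move/fdisjointP: dab => /(_ _ ha); rewrite hb.
Qed.

(** In a factorization of maximal length each column of the product comes from one factor alone.
    With disjoint supports the column itself tells which one. *)
Lemma cf_mul_disj (a b : mtype) : [disjoint finsupp a & finsupp b]%fset ->
  cf (a * b)%M (ealpha a * ealpha b) = 1.
Proof.
move=> dab; have [k1 [k2 [e1 e2 e]]] := exists_typM a b.
have notlt n (l1 l2 : mon2 n) : typ l1 = a -> typ l2 = b -> typ (l1 * l2)%M = (a * b)%M ->
    forall j, col l1 j = 1%M \/ col l2 j = 1%M.
  move=> f1 f2 f; case: (mdeg_typM l1 l2) => //.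
  by rewrite f1 f2 f mdegM ltnn.
have := @cf_mul_uniq _ k1 k2; rewrite e e1 e2; apply => l1 l2 f1 f2 f.
have hk := notlt _ _ _ e1 e2 e; have hl : forall j, _ := notlt _ l1 l2 f1 f2 (etrans (congr1 _ f) e).
apply: col_inj => j; have := congr1 (fun k => col k j) f; rewrite !colM.
case: (hl j) (hk j) => el [] ek; rewrite el ek ?mul1m ?mulm1 //.
  by move=> eq; rewrite (@typ_col_disj a b _ k1 l2 j dab e1 f2).
exact: (@typ_col_disj a b _ l1 k2 j dab f1 e2).
Qed.

End Products.

(** * Triangular arguments for generation *)

Section Generation.
Context {R : comNzRingType} {m : nat}.
Local Notation mon2 n := {cmonom ('I_m * 'I_n)%type}.
Local Notation mtype := {cmonom (Mplus m)}.
Local Notation ealpha := (@ealpha R m).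
Local Notation cf := (@cf R m).

Lemma ealpha1 : ealpha 1%M = 1.
Proof.
apply: val_inj; apply: AseqP => n; apply/malgP => k.
rewrite [LHS]mcoeff_ealpha_seq [RHS]mcoeff1; congr (_%:R); apply: congr1.
apply/eqP/eqP => [e|->].
  apply: col_inj => j; have [/mdeg_eq0I->|h] := posnP (mdeg (col k j)).
    by apply/esym/eqP/cmP => i; rewrite colE !cm1.
  by have := typ_col h; rewrite e mdom1 in_fset0.
rewrite /typ big1 // => j _; rewrite -[RHS]tvar1; apply: congr1.
by apply/eqP/cmP => i; rewrite colE !cm1.
Qed.

Lemma expfset1E (k : nat) (mu nu : Mplus m) :
  [cmonom k | _ in fset1 mu]%M nu = ((mu == nu) * k)%N.
Proof. by rewrite cmE fsfun_fun in_fset1 eq_sym; case: eqP => _; rewrite ?mul1n. Qed.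

Lemma wt_expfset1 k (mu : Mplus m) : wt [cmonom k | _ in fset1 mu]%M = mondeg mu *+ k.
Proof.
rewrite (wtEw (d := fset1 mu)); last first.
  apply/fsubsetP => nu; rewrite -cmE_neq0 expfset1E in_fset1 [nu == mu]eq_sym.
  by case: (mu == nu).
by rewrite big_seq_fset1 expfset1E eqxx mul1n.
Qed.

Definition tw (a : mtype) := (\sum_i wt a i)%N.

Lemma tw_typ n (k : mon2 n) : tw (typ k) = mdeg k.
Proof. by rewrite /tw wt_typ mdeg_multidegree. Qed.

(** At first [S] is a submodule, so that [closed_triangular] serves ideals as well as subalgebras;
    [S1] and [SM] then make it a subalgebra. *)
Variable S : Ainf R m -> Prop.
Hypothesis S0 : S 0.
Hypothesis SL : forall c x y, S x -> S y -> S (c *: x + y).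

(** An invertible coefficient allows the expansion of x to be solved for e_a. *)
Lemma closed_triangular x a u : S x -> u * cf a x = 1 ->
  (forall c, c <> a -> cf c x != 0 -> S (ealpha c)) -> S (ealpha a).
Proof.
move=> Sx ux h; have [D hD] := cf_finite x.
have SN y : S y -> S (- y) by move=> Sy; rewrite -scaleN1r -[_ *: _]addr0; exact: SL.
pose y := \sum_(c <- D | c != a) cf c x *: ealpha c.
have Sy : S y.
  rewrite /y; elim/big_rec: _ => // c z /eqP ca Sz.
  have [->|nz] := eqVneq (cf c x) 0; first by rewrite scale0r add0r.
  by apply: SL => //; apply: h.
suff -> : ealpha a = u *: (x - y).
  by rewrite -[_ *: _]addr0; apply: SL => //; rewrite -[x]scale1r; apply: SL => //; exact: SN.
apply: cfP => b; rewrite linearZ /= linearB /= cf_ealpha /y raddf_sum /=.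
under eq_bigr do rewrite linearZ /= cf_ealpha.
have [<-|ne] := eqVneq a b.
  by rewrite big1 ?subr0 // => c /negbTE->; rewrite mulr0.
have [bD|/negP bD] := boolP (b \in D).
  rewrite -big_filter (bigD1_seq b) /=; last 2 first.
  - by rewrite mem_filter eq_sym ne bD.
  - by rewrite filter_uniq ?fset_uniq.
  rewrite eqxx mulr1 big1 ?addr0 ?subrr ?mulr0 // => c /negbTE->.
  by rewrite mulr0.
have -> : cf b x = 0 by apply/eqP/negPn/negP => /hD.
rewrite big_seq_cond big1 ?subr0 ?mulr0 // => c /andP[cD _].
by case: eqP => [e|]; rewrite ?mulr0 //; case: bD; rewrite -e.
Qed.

Hypothesis S1 : S 1.
Hypothesis SM : forall x y, S x -> S y -> S (x * y).

Lemma cm_divU (I : choiceType) (a : {cmonom I}) i :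
  i \in finsupp a -> exists b, a = (U_(i) * b)%M.
Proof.
rewrite -cmE_neq0 -lt0n => ai; exists (divcm a (ucm i)).
apply/eqP/cmP => j; rewrite cmM cmU divcmE cmU.
by case: eqP => [<-|_]; rewrite ?subnKC // subn0.
Qed.

(** Induction on length: split off one factor mu of [a]. The product of e_1(mu) with the remaining
    e_b has a positive integer coefficient at e_a, and its other terms are shorter. *)
Lemma generation_rat : (forall c : nat, (0 < c)%N -> exists u : R, u * c%:R = 1) ->
  (forall mu, S (emon 1 mu)) -> forall a, S (ealpha a).
Proof.
move=> inv SU a; have [N] := ubnP (mdeg a); elim: N a => // N IH a leN.
have [e|[mu /cm_divU[b ab]]] := fset_0Vmem (finsupp a).
  by rewrite (_ : a = 1%M) ?ealpha1 //; apply: mdeg_eq0I; rewrite mdegE e big_seq_fset0.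
have am : mdeg a = (mdeg b).+1 by rewrite ab mdegM mdegU.
have [c c0 ec] := @cf_mul_top R m U_(mu)%M b; have [u uc] := inv c c0.
apply: (@closed_triangular (ealpha U_(mu)%M * ealpha b) a u).
- by apply: SM; [exact: SU | apply: IH; rewrite -am].
- by rewrite [X in cf X]ab ec.
move=> d da /cf_mul_length[|]; first by rewrite -ab.
by rewrite mdegU add1n -am => lt; apply: IH; apply: leq_trans lt _.
Qed.

Section PowersOfOneMonomial.
Variable nu : Mplus m.
Hypothesis Snu : forall k, S (emon k nu).

Definition powers (a : mtype) :=
  forall mu, mu \in finsupp a -> exists e, val mu = expcmn (val nu) e.

Lemma powers_col n (k : mon2 n) : powers (typ k) ->
  forall j, exists e, col k j = expcmn (val nu) e.
Proof.
move=> h j; have [/mdeg_eq0I->|p] := posnP (mdeg (col k j)); first by exists 0%N.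
exact: h _ (typ_col p).
Qed.

Lemma col_powers n (k : mon2 n) :
  (forall j, exists e, col k j = expcmn (val nu) e) -> powers (typ k).
Proof. by move=> h mu /typ_finsupp[j <-]. Qed.

Definition allcol n : mon2 n := mkcol (fun _ => val nu).

Lemma typ_allcol n : typ (allcol n) = [cmonom n | _ in fset1 nu]%M.
Proof.
apply/eqP/cmP => mu; rewrite typE expfset1E.
under eq_bigr do rewrite col_mkcol (inj_eq val_inj).
by rewrite sum_nat_const card_ord mulnC.
Qed.

Lemma mdeg_typ_allcol n : mdeg (typ (allcol n)) = n.
Proof.
rewrite mdeg_typ (eq_bigr (fun=> 1%N)) ?sum1_card ?card_ord // => j _.
rewrite col_mkcol -mdeg_eq0 -lt0n; by rewrite (valP nu).
Qed.

Lemma typ_allcol_col n N (l : mon2 N) : typ l = typ (allcol n) ->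
  forall j, col l j = 1%M \/ col l j = val nu.
Proof.
move=> e j; have [/mdeg_eq0I->|h] := posnP (mdeg (col l j)); first by left.
have := typ_col h; rewrite e => /typ_finsupp[i]; rewrite col_mkcol => eh.
by right; rewrite [RHS]eh.
Qed.

(** Length n in n columns leaves no room for a trivial column. *)
Lemma typ_allcol_inj n (l : mon2 n) : typ l = typ (allcol n) -> l = allcol n.
Proof.
move=> e; apply: col_inj => j; rewrite col_mkcol.
case: (typ_allcol_col e j) => // c1.
have := mdeg_typ_eq (k := l) (n := n); rewrite e mdeg_typ_allcol => /(_ erefl j).
by rewrite c1 eqxx.
Qed.

(** All columns of the first factor agree, so permuting the second factor only permutes the product.
    Hence e_n(nu) e_b has a single term of length n when b has length at most n. *)
Lemma typ_allcolM n (k2 l1 l2 : mon2 n) : typ l1 = typ (allcol n) ->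
  typ l2 = typ k2 -> typ (l1 * l2)%M = typ (allcol n * k2)%M.
Proof.
move=> /typ_allcol_inj -> /esym /typ_perm[s ->].
rewrite -[RHS](typ_permcol s); apply: congr1; apply: col_inj => j.
by rewrite colM col_permcol !col_mkcol colM col_mkcol.
Qed.

Lemma mdeg_typMl n (k l : mon2 n) : (mdeg (typ k) <= mdeg (typ (k * l)%M))%N.
Proof.
rewrite !mdeg_typ; apply: leq_sum => j _; rewrite colM cmM_eq1.
by case: (_ == _); case: (_ == _).
Qed.

(* Let n = |a|.  Dividing each of the n factors of a by nu gives b of smaller
   weight with e_n(nu) e_b = e_a + terms of the same weight as a and of length
   greater than n. *)
Lemma generation_powers a : powers a -> S (ealpha a).
Proof.
(* The outer induction, on weight, handles e_b; the inner one, on weight minus length, handles the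
   longer terms of equal weight. *)
have [N] := ubnP (tw a); elim: N a => // N IHN a ltN.
have [d] := ubnP (tw a - mdeg a); elim: d a ltN => // d IHd a ltN ltd pa.
have [n an] : exists n, mdeg a = n by exists (mdeg a).
have [n0|n0] := posnP n.
  by move: an; rewrite n0 => /mdeg_eq0I ->; rewrite ealpha1.
have [k ka] : exists k : mon2 n, typ k = a by apply: exists_typ; rewrite an.
(* There are as many columns as factors of [a], so none is trivial and each exponent of nu can be
   lowered by one. *)
have /fin_all_exists[r hr] : forall j, exists e, col k j = expcmn (val nu) e.+1.
  move=> j; have := @powers_col n k; rewrite ka => /(_ pa j)[[|e] he].
    by have := mdeg_typ_eq (k := k) (n := n); rewrite ka => /(_ an j); rewrite he eqxx.
  by exists e.
pose k2 : mon2 n := mkcol (fun j => expcmn (val nu) (r j)).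
have kE : k = (allcol n * k2)%M.
  by apply: col_inj => j; rewrite colM !col_mkcol hr expcmnS.
have twa : tw a = (mdeg (allcol n) + mdeg k2)%N by rewrite -ka tw_typ kE mdegM.
have pk2 : powers (typ k2) by apply: col_powers => j; exists (r j); rewrite col_mkcol.
apply: (@closed_triangular (ealpha (typ (allcol n)) * ealpha (typ k2)) a 1).
- apply: SM; first by rewrite typ_allcol; exact: Snu.
  apply: IHN => //; rewrite tw_typ -ltnS; apply: leq_trans ltN; rewrite ltnS twa.
  rewrite -[X in (X <= _)%N]add1n leq_add2r; apply: leq_trans n0 _.
  by rewrite -[leqLHS](mdeg_typ_allcol n) -tw_typ mdeg_le_wt.
- rewrite mul1r -ka kE; apply: cf_mul_uniq => l1 l2 e1 _ _.
  exact: typ_allcol_inj.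
move=> c ca /cf_mul_neq0[l1 [l2 [e1 e2 ec]]].
have twc : tw c = tw a.
  by rewrite -[in LHS]ec tw_typ mdegM -2!tw_typ e1 e2 !tw_typ twa.
have pc : powers c.
  have := @col_powers _ (l1 * l2)%M; rewrite ec; apply => j; rewrite colM.
  have [e ->] : exists e, col l2 j = expcmn (val nu) e by apply: powers_col; rewrite e2.
  case: (typ_allcol_col e1 j) => ->; first by exists e; rewrite mul1m.
  by exists e.+1; rewrite expcmnS.
have nc : (n < mdeg c)%N.
  have := mdeg_typMl l1 l2; rewrite e1 ec mdeg_typ_allcol leq_eqVlt => /orP[/eqP nc|//].
  exfalso; apply: ca; rewrite -[LHS]ec -ka kE.
  (* The factors [l1] and [l2] live at level [mdeg c], here equal to n; generalizing the level
     permits the substitution. *)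
  have gen N' (h1 h2 : mon2 N') : N' = n -> typ h1 = typ (allcol n) -> typ h2 = typ k2 ->
      typ (h1 * h2)%M = typ (allcol n * k2)%M.
    by move=> eN; subst N'; exact: typ_allcolM.
  exact: gen.
apply: IHd => //; rewrite twc // -ltnS; apply: leq_trans ltd; rewrite ltnS an.
by apply: ltn_sub2l (nc); apply: leq_trans nc _; rewrite -twc; exact: mdeg_le_wt.
Qed.

End PowersOfOneMonomial.

(** Split [a] into the powers of one primitive nu and the rest. If both parts are nontrivial, their
    product has coefficient 1 at e_a and otherwise shorter terms; if there is no rest,
    [generation_powers] applies. *)
Lemma generation_primitive :
  (forall mu : Mplus m, exists2 nu : Mplus m, primitive nu &
     exists e, val mu = expcmn (val nu) e) ->
  (forall k nu, primitive nu -> S (emon k nu)) -> forall a, S (ealpha a).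
Proof.
move=> roots Snu a; have [N] := ubnP (mdeg a); elim: N a => // N IH a leN.
have [e|[mu mua]] := fset_0Vmem (finsupp a).
  by rewrite (_ : a = 1%M) ?ealpha1 //; apply: mdeg_eq0I; rewrite mdegE e big_seq_fset0.
have [nu pnu munu] := roots mu.
pose P (mu' : Mplus m) := `[< exists e, val mu' = expcmn (val nu) e >].
pose a1 : mtype := [cmonom (if P mu' then a mu' else 0) | mu' in finsupp a]%M.
pose a2 : mtype := [cmonom (if P mu' then 0 else a mu') | mu' in finsupp a]%M.
have a1E x : a1 x = if P x then a x else 0%N.
  by rewrite /a1 cmE fsfun_fun; case: (finsuppP a) => //; rewrite if_same.
have a2E x : a2 x = if P x then 0%N else a x.
  by rewrite /a2 cmE fsfun_fun; case: (finsuppP a) => //; rewrite if_same.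
have aE : a = (a1 * a2)%M.
  by apply/eqP/cmP => x; rewrite cmM a1E a2E; case: ifP; rewrite ?addn0.
have Pmu : P mu by apply/asboolP.
have [a20|a20] := posnP (mdeg a2).
  apply: (generation_powers (fun k => Snu k nu pnu)) => x.
  rewrite -cmE_neq0 aE (mdeg_eq0I a20) mulm1 a1E; case: ifP => // /asboolP //.
have a10 : (0 < mdeg a1)%N.
  by apply: leq_trans (mdeg_ge a1 mu); rewrite a1E Pmu lt0n cmE_neq0.
have dis : [disjoint finsupp a1 & finsupp a2]%fset.
  by apply/fdisjointP => x; rewrite -!cmE_neq0 a1E a2E; case: ifP.
have am : mdeg a = (mdeg a1 + mdeg a2)%N by rewrite aE mdegM.
apply: (@closed_triangular (ealpha a1 * ealpha a2) a 1).
- apply: SM; apply: IH; apply: leq_trans (ltnSE leN); rewrite am.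
    by rewrite -[ltnLHS]addn0 ltn_add2l.
  by rewrite -[ltnLHS]add0n ltn_add2r.
- by rewrite mul1r [X in cf X]aE cf_mul_disj.
move=> c ca /cf_mul_length[|]; first by rewrite -aE.
by rewrite -am => lt; apply: IH; apply: leq_trans lt _.
Qed.

End Generation.

(** * Unique primitive roots of monomials *)

Section PrimitiveRoots.
Context {m : nat}.
Local Notation mon := {cmonom 'I_m}.

Definition mgcd (u : mon) : nat := \big[gcdn/0%N]_(i < m) u i.

Definition mroot (u : mon) : mon := [cmonom (u i %/ mgcd u)%N | i in finsupp u]%M.

Lemma dvdn_mgcd u i : (mgcd u %| u i)%N.
Proof. exact: biggcdn_inf. Qed.

Lemma mrootE u i : mroot u i = (u i %/ mgcd u)%N.
Proof. by rewrite /mroot cmE fsfun_fun; case: finsuppP; rewrite ?div0n. Qed.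

Lemma mrootK u : expcmn (mroot u) (mgcd u) = u.
Proof. by apply/eqP/cmP => i; rewrite expcmnE mrootE divnK // dvdn_mgcd. Qed.

Lemma mgcdX (u : mon) k : mgcd (expcmn u k) = (mgcd u * k)%N.
Proof.
rewrite /mgcd (big_morph (fun x => (x * k)%N) (fun x y => muln_gcdl x y k) (mul0n k)).
by apply: eq_bigr => i _; rewrite expcmnE.
Qed.

Lemma mdegX (u : mon) k : mdeg (expcmn u k) = (mdeg u * k)%N.
Proof. by rewrite !mdegT big_distrl; apply: eq_bigr => i _; rewrite expcmnE. Qed.

Lemma mroot_gt0 (mu : Mplus m) : (0 < mdeg (mroot (val mu)))%N.
Proof.
by have := valP mu; rewrite /= -{1}(mrootK (val mu)) mdegX muln_gt0 => /andP[].
Qed.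

Lemma mgcd_gt0 (mu : Mplus m) : (0 < mgcd (val mu))%N.
Proof.
by have := valP mu; rewrite /= -{1}(mrootK (val mu)) mdegX muln_gt0 => /andP[].
Qed.

(** A monomial is the power of its root with exponent the gcd of its exponents; conversely k divides
    that gcd for any k-th power. *)
Lemma primitive_mgcd (nu : Mplus m) : primitive nu <-> mgcd (val nu) = 1%N.
Proof.
split=> [h|h u k k2 e].
  apply/eqP; rewrite eqn_leq mgcd_gt0 andbT leqNgt; apply/negP => g2.
  exact: (h (mroot (val nu)) _ g2 (esym (mrootK _))).
by move: h; rewrite e mgcdX => /eqP; rewrite muln_eq1 => /andP[_ /eqP k1]; rewrite k1 in k2.
Qed.

Definition proot (mu : Mplus m) : Mplus m := MkMplus (mroot_gt0 mu).

Lemma primitive_proot mu : primitive (proot mu).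
Proof.
apply/primitive_mgcd; have := mgcdX (mroot (val mu)) (mgcd (val mu)).
rewrite mrootK -[X in X = _]mul1n => /eqP; rewrite eqn_pmul2r ?mgcd_gt0 //.
by move/eqP.
Qed.

Local Notation prim_powers := {p : nat * Mplus m | (0 < p.1)%N && `[< primitive p.2 >]}.

Lemma prim_power_gt0 (p : prim_powers) :
  (0 < mdeg (expcmn (val (val p).2) (val p).1))%N.
Proof. by rewrite mdegX muln_gt0 (valP (val p).2); case/andP: (valP p). Qed.

Definition prim_power (p : prim_powers) : Mplus m := MkMplus (prim_power_gt0 p).

Lemma prim_root_subproof mu : (0 < (mgcd (val mu), proot mu).1)%N &&
  `[< primitive (mgcd (val mu), proot mu).2 >].
Proof. by rewrite /= mgcd_gt0; apply/asboolP; exact: primitive_proot. Qed.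

Definition prim_root (mu : Mplus m) : prim_powers :=
  exist _ (mgcd (val mu), proot mu) (prim_root_subproof mu).

Lemma prim_powerK : cancel prim_power prim_root.
Proof.
move=> p; have /andP[k0 /asboolP/primitive_mgcd g1] := valP p.
apply: val_inj; rewrite /= [RHS]surjective_pairing; apply: (congr2 pair).
  by rewrite mgcdX g1 mul1n.
apply: val_inj; apply/eqP/cmP => i.
by rewrite /= mrootE mgcdX g1 mul1n expcmnE mulnK.
Qed.

Lemma prim_rootK : cancel prim_root prim_power.
Proof. by move=> mu; apply: val_inj; exact: mrootK. Qed.

(** This supplies the multidegree hypothesis [g_wt] for the generators e_k(nu), with mu = nu^k. *)
Lemma wt_prim_root (mu : Mplus m) :
  wt [cmonom mgcd (val mu) | _ in fset1 (proot mu)]%M = mondeg mu.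
Proof.
rewrite wt_expfset1; apply/ffunP => i; rewrite ffunMnE !ffunE.
have /(congr1 (fun nu : Mplus m => val nu i)) := prim_rootK mu; rewrite /= expcmnE => <-.
by rewrite -mulr_natr natn.
Qed.

End PrimitiveRoots.

(** * The two systems of free generators *)

Section Freeness.
Context {R : comNzRingType} {m : nat}.

Lemma image_linear (I : choiceType) (B : comAlgType R) (g : I -> B) c x y :
  (exists p, peval g p = x) -> (exists p, peval g p = y) ->
  exists p, peval g p = c *: x + y.
Proof. by move=> [p <-] [q <-]; exists (c *: p + q); exact: (linearP (peval g)). Qed.

Lemma image_mul (I : choiceType) (B : comAlgType R) (g : I -> B) x y :
  (exists p, peval g p = x) -> (exists p, peval g p = y) -> exists p, peval g p = x * y.
Proof. by move=> [p <-] [q <-]; exists (p * q); exact: (rmorphM (peval g)). Qed.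

Lemma image1 (I : choiceType) (B : comAlgType R) (g : I -> B) : exists p, peval g p = 1.
Proof. by exists 1; exact: (rmorph1 (peval g)). Qed.

Lemma image0 (I : choiceType) (B : comAlgType R) (g : I -> B) : exists p, peval g p = 0.
Proof. by exists 0; exact: (raddf0 (peval g)). Qed.

Lemma free_primitive : freely_generated
  (fun p : {p : nat * Mplus m | (0 < p.1)%N && `[< primitive p.2 >]} =>
     emon (val p).1 (val p).2 : Ainf R m).
Proof.
pose g (mu : Mplus m) : Ainf R m := emon (mgcd (val mu)) (proot mu).
have gE : (fun p : {p : nat * Mplus m | (0 < p.1)%N && `[< primitive p.2 >]} =>
     emon (val p).1 (val p).2 : Ainf R m) = g \o prim_power.
  apply/funext => p.
  exact: (congr1 (fun q => emon (val q).1 (val q).2) (esym (prim_powerK p))).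
rewrite gE; apply: freely_generated_reindex.
  by exists prim_root; [exact: prim_powerK | exact: prim_rootK].
apply: peval_bij => [mu|].
  by rewrite -wt_prim_root; exact: ealpha_lim.
apply: (@generation_primitive R m (fun x => exists p, peval g p = x)).
- exact: image0.
- exact: image_linear.
- exact: image1.
- exact: image_mul.
- move=> mu; exists (proot mu); first exact: primitive_proot.
  by exists (mgcd (val mu)); rewrite /= mrootK.
(* Generation is stated for all exponents; exponent 0 is not among the generators but gives e_0(nu)
   = 1. *)
move=> [|k] nu pnu.
  suff -> : emon 0 nu = 1 :> Ainf R m by exact: image1.
  rewrite -ealpha1; apply: (congr1 (@ealpha R m)); apply/eqP/cmP => x.
  by rewrite expfset1E muln0 cm1.
have h : (0 < (k.+1, nu).1)%N && `[< primitive (k.+1, nu).2 >] by apply/asboolP.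
exists << U_(prim_power (exist _ (k.+1, nu) h))%M >>; rewrite pevalX.
exact: (esym (congr1 (fun F => F (exist _ (k.+1, nu) h)) gE)).
Qed.

(** This encodes that R contains the rationals: a ring morphism from a field to a nonzero ring is
    injective. *)
Variable iota : {rmorphism rat -> R}.

Lemma rat_inv (c : nat) : (0 < c)%N -> exists u : R, u * c%:R = 1.
Proof.
move=> c0; exists (iota c%:R^-1); rewrite -(rmorph_nat iota) -rmorphM mulVf ?rmorph1 //.
by rewrite Num.Theory.pnatr_eq0 -lt0n.
Qed.

Lemma free_power_sums : freely_generated (fun mu : Mplus m => emon 1 mu : Ainf R m).
Proof.
apply: peval_bij => [mu|].
  by rewrite -[mondeg mu]mulr1n -wt_expfset1; exact: ealpha_lim.
apply: (@generation_rat R m (fun x => exists p, peval _ p = x)).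
- exact: image0.
- exact: image_linear.
- exact: image1.
- exact: image_mul.
- exact: rat_inv.
by move=> mu; exists << U_(mu)%M >>; rewrite pevalX.
Qed.

End Freeness.

(** * Polarization and ideals over the rationals *)

Section Ideal.
Context {R : comNzRingType} {m : nat}.
Local Notation mtype := {cmonom (Mplus m)}.
Local Notation ealpha := (@ealpha R m).
Local Notation cf := (@cf R m).
Local Notation poly := {malg R[{cmonom 'I_m}]}.

Lemma sum_fset_delta (V : zmodType) (K : choiceType) (d : {fset K}) (F : K -> V) x :
  \sum_(i <- d) F i *+ (i == x) = if x \in d then F x else 0.
Proof.
case: ifP => xd.
  rewrite (big_fsetD1 x) //= eqxx mulr1n big_seq big1 ?addr0 // => i.
  by rewrite in_fsetD1 => /andP[/negbTE-> _]; rewrite mulr0n.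
rewrite big_seq big1 // => i id; case: eqP => [e|_]; last by rewrite mulr0n.
by rewrite -e id in xd.
Qed.

Lemma cf_epoly k (f : poly) b : cf b (epoly k f) =
  if mdeg b == k then \prod_(mu <- finsupp b) f@_(val mu) ^+ b mu else 0.
Proof.
set c := fun a : mtype => \prod_(mu <- finsupp a) f@_(val mu) ^+ a mu.
(* The sum defining [epoly] runs over a possibly infinite set; it is cut down to its finite
   support. *)
pose D : {fset mtype} := cardinality.fset_set [set a : mtype | mdeg a = k /\ c a *: ealpha a != 0].
have inD a : (a \in D) = (mdeg a == k) && (c a *: ealpha a != 0).
  rewrite /D cardinality.in_fset_set; last exact: epoly_finite_support.
  by apply/idP/andP; rewrite inE /= => -[/eqP ? ?].
have -> : epoly k f = \sum_(a <- D) c a *: ealpha a.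
  rewrite /epoly (fsbigop.fsbigE (enum_fset D)) //=.
  - rewrite big_seq_cond [RHS]big_seq; apply: eq_bigl => a; apply: andb_idr.
    by rewrite inD => /andP[/eqP e _]; rewrite inE.
  - by move=> a /=; rewrite inD => /andP[/eqP].
  - by move=> a /= ak; rewrite inD ak eqxx /= negbK => /eqP.
rewrite cf_sum; under [LHS]eq_bigr do rewrite linearZ /= cf_ealpha.
have [bD|nbD] := boolP (b \in D).
  move: (bD); rewrite inD => /andP[-> _]; rewrite (big_fsetD1 b) //= eqxx mulr1.
  rewrite big_seq big1 ?addr0 // => a; rewrite in_fsetD1 => /andP[/negbTE-> _].
  by rewrite mulr0.
rewrite big_seq big1 => [|a aD]; last first.
  by case: eqP => [e|_]; [rewrite -e aD in nbD | rewrite mulr0].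
case: eqP => [bk|//]; move: nbD; rewrite inD bk eqxx /= negbK => /eqP /(congr1 (cf b)).
by rewrite linearZ /= cf_ealpha eqxx mulr1 raddf0 => cb; rewrite -[RHS]/(c b) cb.
Qed.

Lemma digits_inj B s (x y : nat -> nat) :
  (forall i, (x i < B)%N) -> (forall i, (y i < B)%N) ->
  (\sum_(i < s) x i * B ^ i = \sum_(i < s) y i * B ^ i)%N ->
  forall i, (i < s)%N -> x i = y i.
Proof.
elim: s x y => [|s IH] x y hx hy //.
have shift (z : nat -> nat) : (\sum_(i < s.+1) z i * B ^ i =
    (\sum_(i < s) z i.+1 * B ^ i) * B + z 0)%N.
  rewrite big_ord_recl /= muln1 addnC big_distrl; congr (_ + _)%N.
  by apply: eq_bigr => i _; rewrite /bump /= add1n expnSr mulnA.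
rewrite !shift => e.
have e0 : x 0%N = y 0%N.
  by have := congr1 (modn^~ B) e; rewrite !modnMDl !modn_small.
have B0 : (0 < B)%N by apply: leq_ltn_trans (hx 0%N).
move: e; rewrite e0 => /addIn /eqP; rewrite eqn_pmul2r // => /eqP e.
by case=> [//|i] lt; apply: (IH (fun i => x i.+1) (fun i => y i.+1)).
Qed.

(** The weights are column e0 of the inverse Vandermonde matrix at the nodes 0, ..., L-1, carried
    from the rationals to R. *)
Lemma interpolation (iota : {rmorphism rat -> R}) L e0 : (e0 < L)%N ->
  exists w : 'I_L -> R, forall e, (e < L)%N ->
    \sum_(c < L) w c * (c : nat)%:R ^+ e = (e == e0)%:R.
Proof.
move=> lt0; pose V : 'M[rat]_L := Vandermonde L (\row_j (j : nat)%:R).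
have Vu : V \in unitmx.
  rewrite unitmxE det_Vandermonde unitfE prodf_seq_neq0; apply/allP => i _ /=.
  rewrite prodf_seq_neq0; apply/allP => j _; apply/implyP => ij.
  rewrite !mxE subr_eq0 Num.Theory.eqr_nat; apply: contraTneq ij => ->.
  by rewrite ltnn.
exists (fun c => iota (invmx V c (Ordinal lt0))) => e lt.
have /matrixP/(_ (Ordinal lt) (Ordinal lt0)) := mulmxV Vu.
rewrite !mxE => /(congr1 iota); rewrite rmorph_sum rmorph_nat => <-.
apply: eq_bigr => c _.
by rewrite !mxE mulrC rmorphM rmorphXn rmorph_nat.
Qed.

Variable I : Ainf R m -> Prop.
Hypothesis I0 : I 0.
Hypothesis IL : forall c x y, I x -> I y -> I (c *: x + y).
Hypothesis IM : forall x y, I y -> I (x * y).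

(* Kronecker substitution: evaluating e_k at f = \sum_i c^(B^i) mu_i gives
   \sum_a c^(code a) e_a with distinct exponents code a, so that Vandermonde
   interpolation in c isolates each e_a. *)
Lemma polarization (iota : {rmorphism rat -> R}) k :
  (forall f : poly, no_constant_term f -> I (epoly k f)) ->
  (0 < k)%N -> forall a, mdeg a = k -> I (ealpha a).
Proof.
(* Exponents of a type of length k are at most k, hence are digits in base B = k+1, and [code]
   determines a type supported in [d]. *)
move=> If k0 a ak; pose d := finsupp a; pose B := k.+1; pose s := #|` d|.
pose idx mu := index mu d.
pose code (b : mtype) := (\sum_(mu <- d) b mu * B ^ idx mu)%N.
pose L := (\sum_(mu <- d) B * B ^ idx mu).+1.
have lek (b : mtype) mu : mdeg b = k -> (b mu < B)%N by move=> bk; rewrite /B -bk ltnS mdeg_ge.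
have codeL b : mdeg b = k -> (code b < L)%N.
  move=> bk; rewrite ltnS; apply: leq_sum => mu _.
  by rewrite leq_mul2r ltnW ?orbT // lek.
have code_inj b : mdeg b = k -> (finsupp b `<=` d)%fset -> code b = code a -> b = a.
  move=> bk bd; case: (fset_0Vmem d) => [d0|[mu0 _]].
    have a0 : mdeg a = 0%N by rewrite mdegE -/d d0 big_seq_fset0.
    by move: k0; rewrite -ak a0.
  have codeE (c : mtype) : code c = (\sum_(i < s) c (nth mu0 d i) * B ^ i)%N.
    rewrite /code (big_nth mu0) big_mkord /s; apply: eq_bigr => i _.
    by rewrite /idx index_uniq ?fset_uniq.
  rewrite !codeE => /(@digits_inj B s (fun i => b (nth mu0 d i)) (fun i => a (nth mu0 d i))
    (fun i => lek b _ bk) (fun i => lek a _ ak)) h.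
  apply/eqP/cmP => mu; have [md|md] := boolP (mu \in d).
    by rewrite -(nth_index mu0 md); apply: h; rewrite index_mem.
  have /eqP-> : b mu == 0%N by rewrite cmE_eq0; apply: contra md; exact: (fsubsetP bd).
  by apply/esym/eqP; rewrite cmE_eq0.
pose f c : poly := \sum_(mu <- d) << (c : nat)%:R ^+ (B ^ idx mu) *g val mu >>.
have fE c mu : (f c)@_(val mu) = if mu \in d then c%:R ^+ (B ^ idx mu) else 0.
  rewrite /f raddf_sum /=; under eq_bigr do rewrite mcoeffU (inj_eq val_inj).
  exact: sum_fset_delta.
have f0 c : no_constant_term (f c).
  rewrite /no_constant_term /f raddf_sum big1 // => mu _ /=; rewrite mcoeffU.
  case: eqP => [e|_]; last by rewrite mulr0n.
  by have := valP mu; rewrite /= e mdeg1.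
have [w hw] := interpolation iota (codeL a ak).
suff -> : ealpha a = \sum_(c < L) w c *: epoly k (f c).
  elim/big_rec: _ => // c x _ Ix; apply: IL => //; exact: If.
apply: cfP => b; rewrite cf_sum cf_ealpha.
under eq_bigr do rewrite linearZ /= cf_epoly.
have [bk|/eqP bk] := eqVneq (mdeg b) k; last first.
  rewrite big1 => [|c _]; last by rewrite mulr0.
  by case: eqP => // e; case: bk; rewrite -e.
have [bd|] := boolP (finsupp b `<=` d)%fset.
  have -> : (a == b) = (code b == code a).
    by apply/eqP/eqP => [->//|/(code_inj b bk bd)].
  rewrite -hw ?codeL //; apply: eq_bigr => c _; apply: (congr1 ( *%R (w c))).
  rewrite (big_fset_incl _ bd) /=; last first.
    by move=> mu _; rewrite -cmE_eq0 => /eqP->; rewrite expr0.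
  rewrite expr_sum big_seq [RHS]big_seq; apply: eq_bigr => mu md.
  by rewrite fE md -exprM mulnC.
(* A type not supported in [d] involves a monomial absent from every [f c], so its coefficient
   vanishes. *)
move=> /fsubsetPn[mu mb md].
rewrite big1 => [|c _]; last first.
  by rewrite (big_fsetD1 mu) //= fE (negbTE md) expr0n cmE_eq0 mb mul0r mulr0.
by case: eqP => // e; rewrite -e -/d (negbTE md) in mb.
Qed.

(** Write [a] as mu times [b], where e_b lies in the ideal by induction. The other terms of e_1(mu)
    e_b are shorter than [a] but no shorter than [b], so their length stays at least k. *)
Lemma ideal_long (iota : {rmorphism rat -> R}) k :
  (forall a, mdeg a = k -> I (ealpha a)) -> forall a, (k <= mdeg a)%N -> I (ealpha a).
Proof.
move=> Ik a; have [N] := ubnP (mdeg a); elim: N a => // N IH a leN.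
rewrite leq_eqVlt => /orP[/eqP/esym|ka]; first exact: Ik.
have [e|[mu /cm_divU[b ab]]] := fset_0Vmem (finsupp a).
  by move: ka; rewrite mdegE e big_seq_fset0.
have am : mdeg a = (mdeg b).+1 by rewrite ab mdegM mdegU.
rewrite am ltnS in ka.
have [c c0 ec] := @cf_mul_top R m U_(mu)%M b; have [u uc] := rat_inv iota c0.
apply: (@closed_triangular R m I I0 IL (ealpha U_(mu)%M * ealpha b) a u).
- by apply: IM; apply: IH => //; rewrite -am.
- by rewrite [X in cf X]ab ec.
move=> x xa nz; apply: IH.
  case: (cf_mul_length nz) => [|lt]; first by rewrite -ab.
  by move: lt; rewrite mdegU add1n -am => lt; apply: leq_trans lt _.
have [l1 [l2 [_ e2 ex]]] := cf_mul_neq0 nz.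
by have := mdeg_typMl l2 l1; rewrite mulmC ex e2; apply: leq_trans.
Qed.

End Ideal.

(** * The kernel as an ideal *)

Section IdealKernel.
Context {R : comNzRingType} {m : nat}.

Lemma ideal_span0 (B : comPzRingType) (P : set B) : ideal_span P 0.
Proof. by exists [::]; rewrite ?big_nil. Qed.

Lemma ideal_spanD (B : comPzRingType) (P : set B) x y :
  ideal_span P x -> ideal_span P y -> ideal_span P (x + y).
Proof.
move=> [s hs ->] [t ht ->]; exists (s ++ t); last by rewrite big_cat.
by move=> p; rewrite mem_cat => /orP[/hs|/ht].
Qed.

Lemma ideal_spanM (B : comPzRingType) (P : set B) x y :
  ideal_span P y -> ideal_span P (x * y).
Proof.
move=> [s hs ->]; exists [seq (x * p.1, p.2) | p <- s].
  by move=> p /mapP[q /hs hq ->].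
by rewrite big_map mulr_sumr; apply: eq_bigr => p _; rewrite mulrA.
Qed.

Lemma mem_ideal_span (B : comPzRingType) (P : set B) x : P x -> ideal_span P x.
Proof.
move=> Px; exists [:: (1, x)]; last by rewrite big_seq1 mul1r.
by move=> p; rewrite inE => /eqP->.
Qed.

Lemma kernel_ideal_span (iota : {rmorphism rat -> R}) n (x : Ainf R m) :
  pitilde n x = 0 <->
  ideal_span [set epoly n.+1 f | f in
    [set f : {malg R[{cmonom 'I_m}]} | no_constant_term f]] x.
Proof.
split=> [|[s hs ->]]; last first.
  rewrite (raddf_sum (pitilde n)) big_seq big1 // => p /hs [f _ pf].
  have p0 : pitilde n p.2 = 0.
    apply/pitilde_eq0 => a le; rewrite -pf cf_epoly; case: eqP => // e.
    by rewrite e ltnn in le.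
  by rewrite [LHS](rmorphM (pitilde n)) /= p0 mulr0.
set P := (X in ideal_span X).
have PZ c y z : ideal_span P y -> ideal_span P z -> ideal_span P (c *: y + z).
  move=> hy; apply: ideal_spanD; rewrite -mulr_algl; exact: ideal_spanM.
(* Polarization provides the e_alpha of length exactly n+1, and [ideal_long] then all longer
   ones. *)
have Pe a : (n < mdeg a)%N -> ideal_span P (ealpha a).
  apply: (ideal_long (ideal_span0 _) PZ _ iota) => [y z|]; first exact: ideal_spanM.
  apply: (polarization (ideal_span0 _) PZ iota) => // f f0.
  by apply: mem_ideal_span; exists f.
move/pitilde_eq0 => h; have [D hD] := cf_finite x; rewrite (cf_expand hD).
elim/big_rec: _ => [|a y _ hy]; first exact: ideal_span0.
have [le|lt] := leqP (mdeg a) n; first by rewrite h // scale0r add0r.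
by apply: PZ => //; exact: Pe.
Qed.

End IdealKernel.

Theorem theorem2 (R : comNzRingType) (n m : nat)
    (hn : (1 <= n)%N) (hm : (2 <= m)%N) :
  (freely_generated
     (fun p : {p : nat * Mplus m | (0 < p.1)%N && `[< primitive p.2 >]} =>
        emon (val p).1 (val p).2 : Ainf R m)
   /\ (forall x : Ainf R m, pitilde n x = 0 <->
         module_span
           [set ealpha alpha | alpha in
             [set alpha : {cmonom (Mplus m)} |
               exists2 k : nat, (1 <= k)%N & mdeg alpha = (n + k)%N]] x))
  /\ (forall iota : {rmorphism rat -> R},
        freely_generated (fun mu : Mplus m => emon 1 mu : Ainf R m)
        /\ (forall x : Ainf R m, pitilde n x = 0 <->
              ideal_span
                [set epoly n.+1 f | f in
                  [set f : {malg R[{cmonom 'I_m}]} | no_constant_term f]] x)).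
Proof.
split; first by split; [exact: free_primitive | exact: kernel_module_span].
move=> iota; split; first exact: free_power_sums iota.
exact: kernel_ideal_span iota n.
Qed.
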